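(* Let $k$ be a field, let $\Delta$ be a $d$-dimensional simplicial complex on $V=\{x_1,\dots,x_n\}$ with $f$-vector $(f_{-1},f_0,\dots,f_d)$, and let $\chi$ be any $s$-colouring of $\Delta$. Let $R=k[x_1,\dots,x_n,y_1,\dots,y_s]$. Then the graded Betti numbers over $R$ of the Stanley-Reisner ideal $I_{\Delta_\chi^\vee}$ of the Alexander dual of $\Delta_\chi$ are given, for all $i\ge0$, by \[ \beta_{i,i+n}(I_{\Delta_\chi^\vee})=\sum_{j=i}^{d+1}\binom{j}{i}f_{j-1}(\Delta). \] In particular, $\operatorname{proj-dim}(I_{\Delta_\chi^\vee})=\operatorname{reg}(R/I_{\Delta_\chi})=d+1$.
   Context: A finite simplicial complex $\Delta$ on a finite vertex set $V$ is a collection of subsets (faces) of $V$ closed under taking subsets and containing $\emptyset$; facets are the inclusion-maximal faces. A face $\sigma$ has dimension $|\sigma|-1$, $\dim\Delta$ is the maximum dimension of a face, and $f_i=f_i(\Delta)$ is the number of faces of dimension $i$ (so $f_{-1}=1$). An $s$-colouring $\chi$ of $\Delta$ is a partition $V=V_1\cup\dots\cup V_s$ into pairwise disjoint, possibly empty sets with $|F\cap V_j|\le1$ for every facet $F$ and every $1\le j\le s$. $\Delta_\chi$ is the simplicial complex on $\{x_1,\dots,x_n,y_1,\dots,y_s\}$ (with $y_1,\dots,y_s$ new vertices) whose faces are the sets $\sigma\cup\tau$ with $\sigma\in\Delta$, $\tau\subseteq\{y_1,\dots,y_s\}$, and $\sigma\cap V_j=\emptyset$ for all $y_j\in\tau$.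 For a simplicial complex $\Gamma$ on vertex set $W$: the Alexander dual is $\Gamma^\vee=\{W\setminus\sigma : \sigma\subseteq W,\ \sigma\notin\Gamma\}$, and the Stanley-Reisner ideal $I_\Gamma\subseteq k[W]$ is the ideal generated by the squarefree monomials $\prod_{w\in\sigma}w$ for $\sigma\subseteq W$, $\sigma\notin\Gamma$. Here $W=\{x_1,\dots,x_n,y_1,\dots,y_s\}$ and $k[W]=R$ with the standard grading. $\beta_{i,j}(M)=\dim_k\operatorname{Tor}_i^R(M,k)_j$ are graded Betti numbers, $\operatorname{proj-dim}$ is projective dimension over $R$, and $\operatorname{reg}$ is Castelnuovo-Mumford regularity. *)

(* Defs.v *)
From HB Require Import structures.
From mathcomp Require Import all_boot all_order all_algebra.
From mathcomp Require Import generic_quotient ring_quotient.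
From mathcomp Require Import boolp.
From mathcomp Require Export mpoly.

Set Implicit Arguments.
Unset Strict Implicit.
Unset Printing Implicit Defensive.

Import GRing.Theory.
Local Open Scope ring_scope.
Local Open Scope quotient_scope.

(** * Simplicial complexes *)

Section Complexes.
Variable T : finType.
Implicit Types (D : {set {set T}}) (F : {set T}).

(* Elements of the vertex set [T] need not themselves be faces. *)
Definition simplicial_complex D : Prop :=
  set0 \in D /\ forall s t : {set T}, s \in D -> t \subset s -> t \in D.

Definition facet D F : Prop :=
  F \in D /\ forall G : {set T}, G \in D -> F \subset G -> G = F.

Definition face_dim F : int := #|F|%:Z - 1.

Definition complex_dim D (d : int) : Prop :=
  (exists2 F, F \in D & face_dim F = d)
  /\ (forall F, F \in D -> (face_dim F <= d)%R).

Definition fnum D (i : int) : nat := #|[set F in D | face_dim F == i]|.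

Definition colouring (s : nat) D (chi : 'I_s -> {set T}) : Prop :=
  [/\ \bigcup_j chi j = [set: T],
      forall i j, i != j -> [disjoint chi i & chi j]
    & forall F j, facet D F -> (#|F :&: chi j| <= 1)%N].

Definition alexander_dual D : {set {set T}} := [set ~: s | s : {set T} & s \notin D].

End Complexes.

(* The vertex [x_i] is [lshift s i] and the vertex [y_j] is [rshift n j]. *)
Definition coloured_complex (n s : nat) (D : {set {set 'I_n}})
    (chi : 'I_s -> {set 'I_n}) : {set {set 'I_(n + s)}} :=
  [set @lshift n s @: sg :|: @rshift n s @: tau
    | sg : {set 'I_n} in D, tau : {set 'I_s} in [set: {set 'I_s}]
      & [forall j in tau, sg :&: chi j == set0]].

(** * Submodules and quotients as modules *)

Section SubQuotient.
Variables (R : nzRingType) (V : lmodType R) (S : submodClosed V).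

Record submod : Type := Submod { submod_val : V; _ : submod_val \in S }.

HB.instance Definition _ := [isSub for submod_val].
HB.instance Definition _ := [Choice of submod by <:].
HB.instance Definition _ := [SubChoice_isSubLmodule of submod by <:].

(* For modules over a ring, [submodClosed] does not carry closure under opposites. *)
Definition submod_pred : {pred V} := S.
HB.instance Definition _ := GRing.isZmodClosed.Build V submod_pred
  (GRing.subsemimod_closedB (GRing.subsemimodClosedP S)).

Definition quotmod : Type := Quotient.quot submod_pred.
HB.instance Definition _ := GRing.Zmodule.on quotmod.

Definition quotmod_proj (v : V) : quotmod := \pi_(Quotient.quot submod_pred) v.

Definition quotmod_scale (a : R) (x : quotmod) : quotmod :=
  quotmod_proj (a *: repr (x : Quotient.quot submod_pred)).

Lemma quotmod_projD : {morph quotmod_proj : u v / u + v}.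
Proof. by move=> u v; rewrite /quotmod_proj raddfD. Qed.

Lemma quotmod_projP (u v : V) : quotmod_proj u = quotmod_proj v <-> u - v \in S.
Proof.
rewrite (Quotient.idealrBE submod_pred u v).
by split=> [e|/eqP //]; apply/eqP.
Qed.

Lemma quotmod_projK (x : quotmod) : quotmod_proj (repr (x : Quotient.quot submod_pred)) = x.
Proof. exact: reprK. Qed.

Lemma quotmod_scaleE a v : quotmod_scale a (quotmod_proj v) = quotmod_proj (a *: v).
Proof.
apply/quotmod_projP; rewrite -scalerBr; apply: rpredZ.
by apply/quotmod_projP; rewrite quotmod_projK.
Qed.

Lemma quotmod_scaleA a b x :
  quotmod_scale a (quotmod_scale b x) = quotmod_scale (a * b) x.
Proof. by rewrite -(quotmod_projK x) !quotmod_scaleE scalerA. Qed.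

Lemma quotmod_scale1 : left_id 1 quotmod_scale.
Proof. by move=> x; rewrite -(quotmod_projK x) quotmod_scaleE scale1r. Qed.

Lemma quotmod_scaleDr : right_distributive quotmod_scale +%R.
Proof.
move=> a x y; rewrite -(quotmod_projK x) -(quotmod_projK y) -quotmod_projD.
by rewrite !quotmod_scaleE -quotmod_projD scalerDr.
Qed.

Lemma quotmod_scaleDl x : {morph quotmod_scale^~ x : a b / a + b}.
Proof.
move=> a b; rewrite -(quotmod_projK x) !quotmod_scaleE.
by rewrite -quotmod_projD scalerDl.
Qed.

HB.instance Definition _ := GRing.Zmodule_isLmodule.Build R quotmod
  quotmod_scaleA quotmod_scale1 quotmod_scaleDr quotmod_scaleDl.

End SubQuotient.

(** * Projective dimension *)

Section ProjDim.
Variable R : nzRingType.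

Definition projective (P : lmodType R) : Prop :=
  forall (N N' : lmodType R) (g : {linear N -> N'}) (f : {linear P -> N'}),
    (forall y, exists x, g x = y) ->
    exists h : {linear P -> N}, forall p, g (h p) = f p.

Record proj_resolution (M : lmodType R) := ProjResolution {
  pres_mod : nat -> lmodType R;
  pres_diff : forall i, {linear pres_mod i.+1 -> pres_mod i};
  pres_aug : {linear pres_mod 0 -> M};
  pres_proj : forall i, projective (pres_mod i);
  pres_surj : forall x, exists y, pres_aug y = x;
  pres_exact0 : forall x, pres_aug x = 0 <-> exists y, pres_diff 0 y = x;
  pres_exact : forall i x,
    pres_diff i x = 0 <-> exists y, pres_diff i.+1 y = x }.

Definition proj_dim_le (M : lmodType R) (p : nat) : Prop :=
  exists P : proj_resolution M, forall i, (p < i)%N -> forall x : pres_mod P i, x = 0.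

Definition is_proj_dim (M : lmodType R) (p : int) : Prop :=
  exists q : nat, [/\ p = q%:Z, proj_dim_le M q
                    & forall q', proj_dim_le M q' -> (q <= q')%N].

End ProjDim.

(** * Graded Betti numbers and regularity over a standard graded polynomial ring *)

Section Betti.
Variables (k : fieldType) (m : nat).
Local Notation R := {mpoly k[m]}.

Definition homogz (d : int) (p : R) : Prop :=
  match d with Posz e => p \is e.-homog | Negz _ => p = 0 end.

Section GradedModule.
(* [Mdeg j] is the degree [j] component of the graded module [M]. *)
Variables (M : lmodType R) (Mdeg : int -> M -> Prop).

(* The free module in homological degree [i] is [\bigoplus_a R(- gres_deg i a)]
   over [a < gres_rank i], whose elements are row vectors, on which the
   differential acts by right multiplication. *)
Record graded_free_resolution := GradedFreeResolution {
  gres_rank : nat -> nat;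
  gres_deg : forall i, 'I_(gres_rank i) -> int;
  gres_diff : forall i, 'M[R]_(gres_rank i.+1, gres_rank i);
  gres_aug : 'I_(gres_rank 0) -> M;
  gres_diff_homog : forall i a b,
    homogz (gres_deg a - gres_deg b) (gres_diff i a b);
  gres_aug_homog : forall a, Mdeg (gres_deg a) (gres_aug a);
  gres_surj : forall x, exists v : 'rV[R]_(gres_rank 0),
    \sum_a v ord0 a *: gres_aug a = x;
  gres_exact0 : forall v : 'rV[R]_(gres_rank 0),
    \sum_a v ord0 a *: gres_aug a = 0 <-> exists w, v = w *m gres_diff 0;
  gres_exact : forall i (v : 'rV[R]_(gres_rank i.+1)),
    v *m gres_diff i = 0 <-> exists w, v = w *m gres_diff i.+1 }.

Section Tor.
Variable F : graded_free_resolution.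

(* [F_i] tensored with [k = R / (variables)] is [k^(gres_rank i)]; the tensored
   differential is obtained by taking constant coefficients. *)
Definition tor_diff (i : nat) : 'M[k]_(gres_rank F i.+1, gres_rank F i) :=
  map_mx (mcoeff 0%MM) (gres_diff F i).

(* Row space: the degree [j] part of [F_i] tensored with [k]. *)
Definition tor_part (i : nat) (j : int) : 'M[k]_(gres_rank F i) :=
  diag_mx (\row_a (gres_deg a == j)%:R).

Definition tor_cycles (i : nat) (j : int) : 'M[k]_(gres_rank F i) :=
  match i with
  | 0 => tor_part 0 j
  | i'.+1 => (tor_part i'.+1 j :&: kermx (tor_diff i'))%MS
  end.

Definition tor_boundaries (i : nat) (j : int) :
    'M[k]_(gres_rank F i.+1, gres_rank F i) :=
  tor_part i.+1 j *m tor_diff i.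

(* Boundaries are contained in cycles, so this is the dimension of the homology
   in degree [j]. *)
Definition tor_dim (i : nat) (j : int) : nat :=
  (\rank (tor_cycles i j) - \rank (tor_boundaries i j))%N.

End Tor.

(* Computed from an arbitrarily chosen resolution. Finitely generated graded
   modules have one; the default value [0] is irrelevant for them. *)
Definition betti (i : nat) (j : int) : nat :=
  match pselect (exists F : graded_free_resolution, True) with
  | left ex => tor_dim (sval (cid ex)) i j
  | right _ => 0
  end.

Definition is_regularity (r : int) : Prop :=
  (exists i j, betti i j <> 0%N /\ j - i%:Z = r)
  /\ (forall i j, betti i j <> 0%N -> (j - i%:Z <= r)%R).

End GradedModule.

Definition submod_deg (I : submodClosed R^o) (j : int) (x : submod I) : Prop :=
  homogz j (submod_val x).

Definition quotmod_deg (I : submodClosed R^o) (j : int) (x : quotmod I) : Prop :=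
  exists2 p : R, homogz j p & quotmod_proj I p = x.

(** * Stanley-Reisner ideals *)

Definition sr_ideal (D : {set {set 'I_m}}) : {pred R^o} :=
  fun p : R => `[< exists c : {set 'I_m} -> R,
    p = \sum_(s : {set 'I_m} | s \notin D) c s * \prod_(w in s) 'X_w >].

Lemma sr_ideal_submod_closed D : submod_closed (sr_ideal D).
Proof.
split=> [|a u v].
  by apply/asboolP; exists (fun=> 0); rewrite big1 // => s _; rewrite mul0r.
move=> /asboolP[c ->] /asboolP[c' ->]; apply/asboolP.
exists (fun s => a * c s + c' s).
rewrite [a *: _]mulr_sumr -big_split /=.
by apply: eq_bigr => s _; rewrite mulrDl mulrA.
Qed.

HB.instance Definition _ D := GRing.isSubmodClosed.Build R R^o (sr_ideal D)
  (sr_ideal_submod_closed D).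

End Betti.

Arguments submod {R V} S.
Arguments quotmod {R V} S.
Arguments betti {k m} M Mdeg i j.
Arguments is_regularity {k m} M Mdeg r.
Arguments submod_deg {k m} I j x.
Arguments quotmod_deg {k m} I j x.
Arguments sr_ideal k {m} D.

(* Main.v *)
(** The faces [t] of [D] index the facets of [Dchi]: [t] together with all [y_j]
whose colour class misses [t]; it has [s] vertices, so its complement has [n].
Both modules are built up by adjoining one generator at a time, with colon ideals
generated by variables.

The ideal of the dual is generated by the monomials of these complements, all of
degree [n]. Added in order of increasing [#|t|], the colon ideal at [t] is
generated by the variables [x_v] with [v] in [t], since [x_v m_t] is a multiple of
[m_(t minus v)]. Splicing in Koszul complexes gives a free resolution with
[binom(#|t|, i)] generators of degree [i + n] for each [t]; it is linear, hence
minimal, which yields the Betti numbers and the projective dimension.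

The face ring of [Dchi] is generated as a module by the monomials [x^t], added in
order of decreasing [#|t|] (the last one is [1]); the colon ideal at [t] is
generated by the [n] variables outside the facet of [t]. So the face ring has a
free resolution with [binom(n, i)] generators of degree [#|t| + i] for each [t].
This bounds the regularity by [max #|t| = d + 1], and in homological degree [n] the
top degree [n + d + 1] cannot cancel. *)

Require Import Defs.
From HB Require Import structures.
From mathcomp Require Import all_boot all_order all_algebra.
From mathcomp Require Import mpoly.
From mathcomp Require Import boolp zify.

Set Implicit Arguments.
Unset Strict Implicit.
Unset Printing Implicit Defensive.

Import GRing.Theory.
Local Open Scope ring_scope.

(** Chain maps and homotopies are built with it one homological degree at a time. The types vary
    with [i], and the invariant [Q] records that the next step can be carried out. *)
Lemma dependent_choice (T : nat -> Type) (Q : forall i, T i -> Prop)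
    (P : forall i, T i -> T i.+1 -> Prop) (x0 : T 0%N) :
  Q 0%N x0 -> (forall i x, Q i x -> exists2 y, P i x y & Q i.+1 y) ->
  exists f : forall i, T i,
    [/\ f 0%N = x0, forall i, Q i (f i) & forall i, P i (f i) (f i.+1)].
Proof.
move=> q0 step.
have next i (x : {x : T i | Q i x}) : {y : T i.+1 | P i (sval x) y /\ Q i.+1 y}.
  by apply: cid; have [y py qy] := step i _ (svalP x); exists y.
pose g := fix g i : {x : T i | Q i x} :=
  if i is i'.+1 then exist _ (sval (next i' (g i'))) (svalP (next i' (g i'))).2
  else exist _ x0 q0.
exists (fun i => sval (g i)); split=> // i; first exact: svalP.
exact: (svalP (next i (g i))).1.
Qed.

(** * Homogeneous components *)

Section HomogeneousComponents.
Variables (k : fieldType) (m : nat).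
Local Notation R := {mpoly k[m]}.
Implicit Types (p q : R) (z w : int).

(** Degrees are integers because differences of generator degrees may be negative; in negative
    degrees the component is 0, in agreement with [homogz]. *)
Definition hcomp z p : R := if z is Posz e then pihomog mdeg e p else 0.

Lemma hcompD z : {morph hcomp z : p q / p + q}.
Proof. by case: z => e p q /=; rewrite ?pihomogD ?addr0. Qed.

Lemma hcomp0 z : hcomp z 0 = 0.
Proof. by case: z => e //=; rewrite pihomog0. Qed.

Lemma hcompB z : {morph hcomp z : p q / p - q}.
Proof. by case: z => e p q /=; rewrite ?pihomogB ?subr0. Qed.

Lemma hcomp_sum z (I : Type) (r : seq I) (P : pred I) (f : I -> R) :
  hcomp z (\sum_(i <- r | P i) f i) = \sum_(i <- r | P i) hcomp z (f i).
Proof. exact: (big_morph (hcomp z) (hcompD z) (hcomp0 z)). Qed.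

Lemma hcomp_homogz z p : homogz z (hcomp z p).
Proof. by case: z => e //=; exact: pihomogP. Qed.

Lemma homogz0 z : homogz z (0 : R).
Proof. by case: z => e //=; exact: dhomog0. Qed.

Lemma homogzD z p q : homogz z p -> homogz z q -> homogz z (p + q).
Proof. by case: z => e /=; [exact: dhomogD | move=> -> ->; rewrite addr0]. Qed.

Lemma homogzN z p : homogz z p -> homogz z (- p).
Proof. by case: z => e /=; [rewrite dhomogN | move=> ->; rewrite oppr0]. Qed.

Lemma homogz1 z : z = 0 -> homogz z (1 : R).
Proof. by move=> ->; exact: dhomog1. Qed.

Lemma homogzM z w p q : homogz z p -> homogz w q -> homogz (z + w) (p * q).
Proof.
case: z => e /= hp; last by rewrite hp mul0r => _; exact: homogz0.
case: w => e' /= hq; last by rewrite hq mulr0; exact: homogz0.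
exact: dhomogM.
Qed.

Lemma homogz_sum z (I : Type) (r : seq I) (P : pred I) (f : I -> R) :
  (forall i, P i -> homogz z (f i)) -> homogz z (\sum_(i <- r | P i) f i).
Proof.
move=> h; elim/big_ind: _ => //; [exact: homogz0 | exact: homogzD].
Qed.

Lemma homogz_coef0 z p : homogz z p -> z != 0 -> p@_0%MM = 0.
Proof.
case: z => e /= hp; last by rewrite hp mcoeff0.
by move=> e0; apply: (dhomog_nemf_coeff hp); rewrite mf0; lia.
Qed.

Lemma hcomp_id z p : homogz z p -> hcomp z p = p.
Proof. by case: z => e /=; [exact: pihomog_dE | move=> ->]. Qed.

Lemma hcomp_neq z w p : homogz z p -> z != w -> hcomp w p = 0.
Proof.
case: z => e /= hp; last by rewrite hp hcomp0.
by case: w => // e' ne /=; apply: (pihomog_ne0 _ hp); apply: contra_neq ne => ->.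
Qed.

(** By additivity [p] may be taken to be a single term; then both sides are the whole product or
    both are 0, according to the degree of the term. *)
Lemma hcompM z w p q : homogz w q -> hcomp (z + w) (p * q) = hcomp z p * q.
Proof.
move=> hq; rewrite [p]mpolyE mulr_suml !hcomp_sum mulr_suml.
apply: eq_bigr => u _.
have hu : homogz (mdeg u) (p@_u *: 'X_[u] : R) by apply: dhomogZ; rewrite dhomogX.
have huq := homogzM hu hq.
have [e|ne] := eqVneq (mdeg u)%:Z z.
  by rewrite -e (hcomp_id huq) (hcomp_id hu).
rewrite (hcomp_neq hu ne) mul0r; apply: (hcomp_neq huq).
by apply: contra_neq ne => /addIr.
Qed.

(* The second clause replaces a direct sum decomposition of [M]: in an expression of
   a homogeneous element through homogeneous elements, the coefficients may be
   replaced by their components of the right degrees. *)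
Definition graded_module (M : lmodType R) (Mdeg : int -> M -> Prop) : Prop :=
  (forall z w p x, homogz z p -> Mdeg w x -> Mdeg (z + w) (p *: x))
  /\ forall z x r (dg : 'I_r -> int) (g : 'I_r -> M) (v : 'I_r -> R),
       (forall a, Mdeg (dg a) (g a)) -> Mdeg z x -> x = \sum_a v a *: g a ->
       x = \sum_a hcomp (z - dg a) (v a) *: g a.

Definition homogmx r c (dr : 'I_r -> int) (dc : 'I_c -> int) (A : 'M[R]_(r, c)) :=
  forall a b, homogz (dr a - dc b) (A a b).

(** The degree-preserving component of a map between graded free modules. *)
Definition hcompmx r c (dr : 'I_r -> int) (dc : 'I_c -> int) (A : 'M[R]_(r, c)) :=
  \matrix_(a, b) hcomp (dr a - dc b) (A a b).

Section HomogeneousMatrices.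
Variables (r c t : nat) (dr : 'I_r -> int) (dc : 'I_c -> int) (dt : 'I_t -> int).

Lemma hcompmx_homog (A : 'M[R]_(r, c)) : homogmx dr dc (hcompmx dr dc A).
Proof. by move=> a b; rewrite mxE; exact: hcomp_homogz. Qed.

Lemma hcompmx_id (A : 'M[R]_(r, c)) : homogmx dr dc A -> hcompmx dr dc A = A.
Proof. by move=> h; apply/matrixP => a b; rewrite mxE hcomp_id. Qed.

Lemma hcompmxM (A : 'M[R]_(r, c)) (B : 'M[R]_(c, t)) : homogmx dc dt B ->
  hcompmx dr dt (A *m B) = hcompmx dr dc A *m B.
Proof.
move=> hB; apply/matrixP => a b; rewrite !mxE hcomp_sum.
apply: eq_bigr => x _; rewrite mxE -(hcompM _ _ (hB x b)).
by congr hcomp; rewrite addrA subrK.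
Qed.

Lemma hcompmxMl (A : 'M[R]_(r, c)) (B : 'M[R]_(c, t)) : homogmx dr dc A ->
  hcompmx dr dt (A *m B) = A *m hcompmx dc dt B.
Proof.
move=> hA; apply/matrixP => a b; rewrite !mxE hcomp_sum.
apply: eq_bigr => x _; rewrite mxE [RHS]mulrC -(hcompM _ _ (hA a x)) mulrC.
by congr hcomp; lia.
Qed.

Lemma homogmxM (A : 'M[R]_(r, c)) (B : 'M[R]_(c, t)) :
  homogmx dr dc A -> homogmx dc dt B -> homogmx dr dt (A *m B).
Proof.
move=> hA hB a b; rewrite mxE; apply: homogz_sum => x _.
by rewrite -(subrK (dc x) (dr a)) -addrA; exact: homogzM.
Qed.

Lemma homogmxB (A B : 'M[R]_(r, c)) :
  homogmx dr dc A -> homogmx dr dc B -> homogmx dr dc (A - B).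
Proof. by move=> hA hB a b; rewrite !mxE; apply: homogzD => //; exact: homogzN. Qed.

End HomogeneousMatrices.

Lemma homogmx1 r (dr : 'I_r -> int) : homogmx dr dr 1%:M.
Proof.
move=> a b; rewrite mxE; have [->|_] := eqVneq a b.
  by apply: homogz1; rewrite subrr.
exact: homogz0.
Qed.

End HomogeneousComponents.

(** * Graded complexes of free modules *)

Section Complexes.
Variables (k : fieldType) (m : nat).
Local Notation R := {mpoly k[m]}.

(** Exactness starts in homological degree 1. The cokernel in degree 0 is the resolved module, and
    the augmentation is supplied separately by [resolves]. *)
Record gcomplex := GComplex {
  grank : nat -> nat;
  gdeg : forall i, 'I_(grank i) -> int;
  gdiff : forall i, 'M[R]_(grank i.+1, grank i);
  gdiff_homog : forall i, homogmx (@gdeg i.+1) (@gdeg i) (gdiff i);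
  gexact : forall i (v : 'rV[R]_(grank i.+1)),
    v *m gdiff i = 0 <-> exists w, v = w *m gdiff i.+1 }.

(** Preimages are chosen row by row; the degree-preserving component of the resulting matrix is
    still a lift, since taking components commutes with multiplication by the homogeneous [D]. *)
Lemma rows_lift r c t (dr : 'I_r -> int) (dc : 'I_c -> int) (dt : 'I_t -> int)
    (A : 'M[R]_(r, t)) (D : 'M[R]_(c, t)) :
  homogmx dr dt A -> homogmx dc dt D ->
  (forall a, exists w : 'rV_c, row a A = w *m D) ->
  exists2 W : 'M_(r, c), homogmx dr dc W & A = W *m D.
Proof.
move=> hA hD /choice[w hw]; exists (hcompmx dr dc (\matrix_a w a)).
  exact: hcompmx_homog.
rewrite -(hcompmxM _ _ hD) -[LHS](hcompmx_id hA); congr hcompmx.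
by apply/row_matrixP => a; rewrite row_mul rowK hw.
Qed.

Section Lifting.
Variable C : gcomplex.

Lemma gdiffK i : gdiff C i.+1 *m gdiff C i = 0.
Proof.
apply/row_matrixP => a; rewrite row_mul row0; apply/gexact.
by exists (delta_mx 0 a); rewrite rowE.
Qed.

Lemma gexact_lift i r (dr : 'I_r -> int) (A : 'M[R]_(r, grank C i.+1)) :
  homogmx dr (@gdeg C i.+1) A -> A *m gdiff C i = 0 ->
  exists2 W, homogmx dr (@gdeg C i.+2) W & A = W *m gdiff C i.+1.
Proof.
move=> hA A0; apply: (rows_lift hA (@gdiff_homog C _)) => a.
by apply/gexact; rewrite -row_mul A0 row0.
Qed.

End Lifting.

(** The second hypothesis provides the first lift, as [C] is not exact in degree 0; from then on
    exactness of [C] provides the next one. *)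
Lemma chain_map_exists (B C : gcomplex) (f0 : 'M_(grank B 0, grank C 0)) :
  homogmx (@gdeg B 0) (@gdeg C 0) f0 ->
  (exists2 W, homogmx (@gdeg B 1) (@gdeg C 1) W &
              gdiff B 0 *m f0 = W *m gdiff C 0) ->
  exists f : forall i, 'M_(grank B i, grank C i),
    [/\ f 0%N = f0, forall i, homogmx (@gdeg B i) (@gdeg C i) (f i)
      & forall i, gdiff B i *m f i = f i.+1 *m gdiff C i].
Proof.
move=> h0 l0.
pose Q i (x : 'M_(grank B i, grank C i)) := homogmx (@gdeg B i) (@gdeg C i) x /\
  exists2 W, homogmx (@gdeg B i.+1) (@gdeg C i.+1) W &
             gdiff B i *m x = W *m gdiff C i.
pose P i (x : 'M_(grank B i, grank C i)) (y : 'M_(grank B i.+1, grank C i.+1)) :=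
  gdiff B i *m x = y *m gdiff C i.
have [||f [f0E fQ fP]] := @dependent_choice _ Q P f0.
- by split.
- move=> i x [hx [y hy xy]]; exists y => //; split=> //.
  apply: gexact_lift; first exact: homogmxM (@gdiff_homog B _) hy.
  by rewrite -mulmxA -xy mulmxA gdiffK mul0mx.
by exists f; split=> // i; case: (fQ i).
Qed.

(** At each stage [f] minus the part of the homotopy already built is killed by the differential,
    hence lifts by exactness. *)
Lemma homotopy_exists (C : gcomplex) (f : forall i, 'M_(grank C i)) h0 :
  (forall i, homogmx (@gdeg C i) (@gdeg C i) (f i)) ->
  (forall i, gdiff C i *m f i = f i.+1 *m gdiff C i) ->
  homogmx (@gdeg C 0) (@gdeg C 1) h0 -> f 0%N = h0 *m gdiff C 0 ->
  exists h : forall i, 'M_(grank C i, grank C i.+1),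
    [/\ h 0%N = h0, forall i, homogmx (@gdeg C i) (@gdeg C i.+1) (h i)
      & forall i, f i.+1 = h i.+1 *m gdiff C i.+1 + gdiff C i *m h i].
Proof.
move=> hf cf hh0 f0E.
pose Q i (x : 'M_(grank C i, grank C i.+1)) :=
  homogmx (@gdeg C i) (@gdeg C i.+1) x /\
  (f i.+1 - gdiff C i *m x) *m gdiff C i = 0.
pose P i (x : 'M_(grank C i, grank C i.+1)) (y : 'M_(grank C i.+1, grank C i.+2)) :=
  f i.+1 = y *m gdiff C i.+1 + gdiff C i *m x.
have [||h [h0E hQ hP]] := @dependent_choice _ Q P h0.
- by split=> //; rewrite mulmxBl -cf f0E mulmxA subrr.
- move=> i x [hx x0].
  have [|y hy xy] := @gexact_lift C i _ (@gdeg C i.+1) _ _ x0.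
    by apply: homogmxB => //; apply: homogmxM (@gdiff_homog C _) hx.
  exists y; first by rewrite /P -xy subrK.
  split=> //; rewrite mulmxBl -mulmxA -xy mulmxBr mulmxA gdiffK mul0mx subr0.
  by rewrite cf subrr.
by exists h; split=> // i; case: (hQ i).
Qed.

Definition gcount (C : gcomplex) i j : nat := #|[pred a : 'I_(grank C i) | gdeg a == j]|.

Definition gshift (e : int) (C : gcomplex) : gcomplex.
Proof.
exists (grank C) (fun i a => gdeg a + e) (gdiff C); last exact: gexact.
by move=> i a b; rewrite opprD addrACA subrr addr0; exact: gdiff_homog.
Defined.

End Complexes.

(** * Comparing dimensions of homology over a field *)

Section Homology.
Variables (F : fieldType) (r b r' b' : nat).

(** The kernel of the map from [Z] to [Z'/B'] induced by [f] lies in [B], because [g] sends [B']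
    into [B] and [f] followed by [g] is the identity modulo [B]. *)
Lemma homology_dim_le (Z : 'M[F]_r) (B : 'M_(b, r)) (Z' : 'M_r') (B' : 'M_(b', r'))
    (f : 'M_(r, r')) (g : 'M_(r', r)) :
  (Z *m f <= Z')%MS -> (B' <= Z')%MS -> (B' *m g <= B)%MS ->
  (forall v : 'rV_r, (v <= Z)%MS -> (v *m f *m g - v <= B)%MS) ->
  (\rank Z - \rank B <= \rank Z' - \rank B')%N.
Proof.
move=> ZZ' BZ' BB hfg; pose K := cokermx B'.
have kerB : (Z :&: kermx (f *m K) <= B)%MS.
  apply/rV_subP => v; rewrite sub_capmx => /andP[vZ /sub_kermxP vK].
  have vB : (v *m f *m g <= B)%MS.
    by apply: submx_trans BB; apply: submxMr; rewrite submxE -mulmxA vK.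
  by rewrite -[v](subKr (v *m f *m g)) addmx_sub // eqmx_opp hfg.
have := mxrank_mul_ker Z (f *m K); have := mxrank_mul_ker Z' K.
have le1 := mxrankS kerB.
have le2 : (\rank B' <= \rank (Z' :&: kermx K))%N.
  by apply: mxrankS; rewrite sub_capmx BZ'; apply/sub_kermxP; exact: mulmx_coker.
have le3 : (\rank (Z *m (f *m K)) <= \rank (Z' *m K))%N.
  by rewrite mulmxA; apply/mxrankS/submxMr.
lia.
Qed.

End Homology.

(** * Reduction to constant coefficients, degree by degree *)

Section DegreePart.
Variables (k : fieldType) (m : nat).
Local Notation R := {mpoly k[m]}.
Local Notation const A := (map_mx (mcoeff 0%MM) A).

Definition degpart r (dg : 'I_r -> int) (j : int) : 'M[k]_r :=
  diag_mx (\row_a (dg a == j)%:R).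

(** A homogeneous entry of nonzero degree has no constant coefficient, so the reduced matrix only
    links generators of equal degree. *)
Lemma degpart_comm r c (dr : 'I_r -> int) (dc : 'I_c -> int) (A : 'M[R]_(r, c)) j :
  homogmx dr dc A -> degpart dr j *m const A = const A *m degpart dc j.
Proof.
move=> hA; rewrite mul_diag_mx mul_mx_diag; apply/matrixP => a b; rewrite !mxE mulrC.
have [-> //|ne] := eqVneq (dr a) (dc b).
by rewrite (homogz_coef0 (hA a b)) ?mul0r // subr_eq0.
Qed.

Lemma degpart_idem r (dg : 'I_r -> int) j : degpart dg j *m degpart dg j = degpart dg j.
Proof.
rewrite mul_diag_mx; apply/matrixP => a b; rewrite !mxE.
by case: eqVneq => _; rewrite ?mul1r // mul0r mul0rn.
Qed.

Lemma sub_degpart n r (dg : 'I_r -> int) j (v : 'M_(n, r)) :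
  (v <= degpart dg j)%MS = (v *m degpart dg j == v).
Proof.
apply/idP/eqP => [/submxP[w ->]|<-]; last exact: submxMl.
by rewrite -mulmxA degpart_idem.
Qed.

Lemma rank_degpart r (dg : 'I_r -> int) j :
  \rank (degpart dg j) = #|[pred a | dg a == j]|.
Proof.
pose A := [pred a | dg a == j].
(* [E] is the inclusion of the coordinates of degree [j]; the projection factors as [E^T *m E],
   while [E *m E^T] is the identity of size [#|A|]. *)
pose E : 'M[k]_(#|A|, r) := \matrix_(x, b) (enum_val x == b)%:R.
have EE : E *m E^T = 1%:M.
  apply/matrixP => x y; rewrite !mxE (bigD1 (enum_val x)) //= !mxE eqxx mul1r.
  rewrite big1 ?addr0 => [|b /negPf ne]; last by rewrite !mxE eq_sym ne mul0r.
  by rewrite (inj_eq enum_val_inj) eq_sym.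
have -> : degpart dg j = E^T *m E.
  apply/matrixP => a b; rewrite !mxE.
  have [ja|nja] := eqVneq (dg a) j; last first.
    rewrite mul0rn big1 // => x _; rewrite !mxE.
    case: eqVneq => [e|]; last by rewrite mul0r.
    by have := enum_valP x; rewrite e inE (negPf nja).
  have aA : a \in A by rewrite inE ja.
  rewrite (bigD1 (enum_rank_in aA a)) //= !mxE enum_rankK_in // eqxx mul1r.
  rewrite big1 ?addr0 // => x ne; rewrite !mxE.
  case: eqVneq => [e|]; last by rewrite mul0r.
  by case/eqP: ne; apply: enum_val_inj; rewrite enum_rankK_in.
apply/anti_leq/andP; split.
  by apply: leq_trans (mxrankM_maxr _ _) (rank_leq_row _).
have rk : (\rank (1%:M : 'M[k]_#|A|) <= \rank (E^T *m E))%N.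
  have -> : 1%:M = E *m (E^T *m E) *m E^T by rewrite !mulmxA EE mul1mx EE.
  exact: leq_trans (mxrankM_maxl _ _) (mxrankM_maxr _ _).
by rewrite mxrank1 in rk.
Qed.

End DegreePart.

(** * Invariance of Tor *)

Section Augmentation.
Variables (k : fieldType) (m : nat).
Local Notation R := {mpoly k[m]}.
Variables (M : lmodType R) (Mdeg : int -> M -> Prop).

Definition lincomb r (g : 'I_r -> M) (v : 'rV[R]_r) : M := \sum_a v 0 a *: g a.

Lemma lincombD r (g : 'I_r -> M) u v : lincomb g (u + v) = lincomb g u + lincomb g v.
Proof.
by rewrite /lincomb -big_split; apply: eq_bigr => a _; rewrite !mxE scalerDl.
Qed.

Lemma lincombN r (g : 'I_r -> M) u : lincomb g (- u) = - lincomb g u.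
Proof.
by rewrite /lincomb -sumrN; apply: eq_bigr => a _; rewrite !mxE scaleNr.
Qed.

Lemma lincombB r (g : 'I_r -> M) u v : lincomb g (u - v) = lincomb g u - lincomb g v.
Proof. by rewrite lincombD lincombN. Qed.

Lemma lincomb_is_linear r (g : 'I_r -> M) : linear (lincomb g).
Proof.
move=> p u v; rewrite lincombD; congr (_ + _); rewrite /lincomb scaler_sumr.
by apply: eq_bigr => a _; rewrite mxE scalerA.
Qed.

HB.instance Definition _ r (g : 'I_r -> M) :=
  GRing.isLinear.Build R 'rV[R]_r M *:%R (lincomb g) (lincomb_is_linear g).

Lemma lincombM r c (g : 'I_c -> M) (w : 'rV[R]_r) (A : 'M_(r, c)) :
  lincomb g (w *m A) = lincomb (fun a => lincomb g (row a A)) w.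
Proof.
rewrite /lincomb [RHS](eq_bigr (fun a => \sum_b w 0 a *: (A a b *: g b))); last first.
  by move=> a _; rewrite scaler_sumr; apply: eq_bigr => b _; rewrite mxE.
rewrite exchange_big; apply: eq_bigr => b _; rewrite mxE scaler_suml.
by apply: eq_bigr => a _; rewrite scalerA.
Qed.

Lemma lincomb_delta r (g : 'I_r -> M) a : lincomb g (delta_mx 0 a) = g a.
Proof.
rewrite /lincomb (bigD1 a) //= mxE !eqxx scale1r big1 ?addr0 // => b /negPf ne.
by rewrite mxE ne andbF scale0r.
Qed.

(** The resolved submodule is a predicate [N] on a fixed ambient module, so that it can grow by one
    generator at a time without a change of type. *)
Definition resolves (C : gcomplex k m) (N : M -> Prop) (g : 'I_(grank C 0) -> M) :=
  [/\ forall a, Mdeg (gdeg a) (g a),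
      forall x, N x <-> exists v, lincomb g v = x
    & forall v, lincomb g v = 0 <-> exists w, v = w *m gdiff C 0].

Arguments resolves C N g : clear implicits.

Lemma resolves_lift (C : gcomplex k m) N g r (dx : 'I_r -> int) (x : 'I_r -> M) :
  graded_module Mdeg -> resolves C N g ->
  (forall a, Mdeg (dx a) (x a)) -> (forall a, N (x a)) ->
  exists2 W : 'M_(r, grank C 0), homogmx dx (@gdeg _ _ C 0) W &
    forall a, x a = lincomb g (row a W).
Proof.
move=> [_ gM] [hg im _] hx Nx.
have /choice[v hv] : forall a, exists v, lincomb g v = x a by move=> a; apply/im.
exists (hcompmx dx (@gdeg _ _ C 0) (\matrix_a v a)); first exact: hcompmx_homog.
move=> a; rewrite [LHS](gM _ _ _ _ _ (v a 0) hg (hx a) (esym (hv a))).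
by apply: eq_bigr => b _; rewrite !mxE.
Qed.

Lemma lincomb_lift (C : gcomplex k m) N g r (dx : 'I_r -> int) (W : 'M_(r, grank C 0)) :
  resolves C N g -> homogmx dx (@gdeg _ _ C 0) W ->
  (forall a, lincomb g (row a W) = 0) ->
  exists2 V : 'M_(r, grank C 1), homogmx dx (@gdeg _ _ C 1) V & W = V *m gdiff C 0.
Proof.
move=> [_ _ ker] hW W0; apply: rows_lift => // [|a]; first exact: gdiff_homog.
exact/ker.
Qed.

Lemma lincomb_diff0 (C : gcomplex k m) N g a :
  resolves C N g -> lincomb g (row a (gdiff C 0)) = 0.
Proof. by move=> [_ _ ker]; apply/ker; exists (delta_mx 0 a); rewrite rowE. Qed.

Definition comparison (B C : gcomplex k m) (gB : 'I_(grank B 0) -> M)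
    (gC : 'I_(grank C 0) -> M) (f : forall i, 'M_(grank B i, grank C i)) :=
  [/\ forall i, homogmx (@gdeg _ _ B i) (@gdeg _ _ C i) (f i),
      forall a, lincomb gC (row a (f 0%N)) = gB a
    & forall i, gdiff B i *m f i = f i.+1 *m gdiff C i].

Lemma comparison_exists (B C : gcomplex k m) N gB gC :
  graded_module Mdeg -> resolves B N gB -> resolves C N gC ->
  exists f, comparison gB gC f.
Proof.
move=> gM rB rC; have [hB imB _] := rB.
have [|f0 hf0 f0E] := resolves_lift gM rC hB.
  by move=> a; apply/imB; exists (delta_mx 0 a); exact: lincomb_delta.
have [|f []] := @chain_map_exists _ _ B C f0 hf0.
  apply: (lincomb_lift rC) => [|a]; first exact: homogmxM (@gdiff_homog _ _ B 0) hf0.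
  rewrite row_mul lincombM -[RHS](lincomb_diff0 a rB).
  by apply: eq_bigr => b _; rewrite f0E.
by move=> fE hf cf; exists f; split=> // a; rewrite fE f0E.
Qed.

Lemma comparison_homotopy (C : gcomplex k m) N g f :
  resolves C N g -> comparison g g f ->
  exists h : forall i, 'M_(grank C i, grank C i.+1),
    [/\ forall i, homogmx (@gdeg _ _ C i) (@gdeg _ _ C i.+1) (h i),
        f 0%N - 1%:M = h 0%N *m gdiff C 0
      & forall i, f i.+1 - 1%:M = h i.+1 *m gdiff C i.+1 + gdiff C i *m h i].
Proof.
move=> rC [hf f0 cf].
have hf1 i : homogmx (@gdeg _ _ C i) (@gdeg _ _ C i) (f i - 1%:M).
  by apply: homogmxB => //; exact: homogmx1.
have [a|h0 hh0 h0E] := lincomb_lift rC (hf1 0%N).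
  by rewrite linearB /= lincombB f0 -[1%:M]trmx1 rowE trmx1 mulmx1 lincomb_delta subrr.
have [i|h [hE hh hf']] := homotopy_exists hf1 _ hh0 h0E.
  by rewrite mulmxBl mulmxBr cf mulmx1 mul1mx.
by exists h; split=> //; rewrite hE.
Qed.

End Augmentation.

Arguments resolves {k m M} Mdeg C N g.

Section TorInvariance.
Variables (k : fieldType) (m : nat).
Local Notation R := {mpoly k[m]}.
Variables (M : lmodType R) (Mdeg : int -> M -> Prop).
Local Notation const A := (map_mx (mcoeff 0%MM) A).

Definition gcomplex_of (F : graded_free_resolution Mdeg) : gcomplex k m :=
  GComplex (@gres_diff_homog _ _ _ _ F) (@gres_exact _ _ _ _ F).

Lemma gcomplex_of_resolves (F : graded_free_resolution Mdeg) :
  resolves Mdeg (gcomplex_of F) (fun=> True) (@gres_aug _ _ _ _ F).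
Proof.
split=> [|x|v]; [exact: gres_aug_homog | | exact: gres_exact0].
by split=> // _; exact: gres_surj.
Qed.

Lemma tor_diffP (F : graded_free_resolution Mdeg) i j :
  tor_part F i.+1 j *m tor_diff F i = tor_diff F i *m tor_part F i j.
Proof. exact/degpart_comm/gres_diff_homog. Qed.

Lemma tor_diffK (F : graded_free_resolution Mdeg) i :
  tor_diff F i.+1 *m tor_diff F i = 0.
Proof. by rewrite -map_mxM (gdiffK (gcomplex_of F)) map_mx0. Qed.

Lemma tor_boundaries_cycles (F : graded_free_resolution Mdeg) i j :
  (tor_boundaries F i j <= tor_cycles F i j)%MS.
Proof.
rewrite /tor_boundaries tor_diffP; case: i => [|i] /=; first exact: submxMl.
rewrite sub_capmx submxMl; apply/sub_kermxP.
by rewrite -tor_diffP -mulmxA tor_diffK mulmx0.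
Qed.

(** Comparison maps in both directions compose to a map homotopic to the identity, so the homology
    of the reduced [F] embeds in that of [G]. Exchanging the roles gives equality. *)
Lemma tor_dim_le (F G : graded_free_resolution Mdeg) i j :
  graded_module Mdeg -> (tor_dim F i j <= tor_dim G i j)%N.
Proof.
move=> gM; have rF := gcomplex_of_resolves F; have rG := gcomplex_of_resolves G.
have [f cf] := comparison_exists gM rF rG; have [g cg] := comparison_exists gM rG rF.
have [hf f0 fd] := cf; have [hg g0 gd] := cg.
have [|h [hh hE0 hE]] := @comparison_homotopy _ _ _ _ _ _ _ (fun i => f i *m g i) rF.
  split=> [l|a|l]; first exact: homogmxM.
    by rewrite row_mul lincombM -[RHS]f0; apply: eq_bigr => b _; rewrite g0.
  by rewrite mulmxA fd -mulmxA gd mulmxA.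
have fd' l : tor_diff F l *m const (f l) = const (f l.+1) *m tor_diff G l.
  by rewrite /tor_diff -!map_mxM fd.
have gd' l : tor_diff G l *m const (g l) = const (g l.+1) *m tor_diff F l.
  by rewrite /tor_diff -!map_mxM gd.
have fP l := degpart_comm j (hf l).
have gP l := degpart_comm j (hg l).
have hP l := degpart_comm j (hh l).
rewrite /tor_dim; apply: (@homology_dim_le _ _ _ _ _ _ _ _ _ (const (f i)) (const (g i))).
- case: i => [|i] /=; first by rewrite /tor_part [X in (X <= _)%MS]fP submxMl.
  rewrite sub_capmx; apply/andP; split.
    apply: (submx_trans (submxMr _ (capmxSl _ _))).
    by rewrite [X in (X <= _)%MS]fP submxMl.
  apply/sub_kermxP; rewrite -mulmxA -fd' mulmxA.
  have /sub_kermxP -> := capmxSr (tor_part F i.+1 j) (kermx (tor_diff F i)).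
  by rewrite mul0mx.
- exact: tor_boundaries_cycles.
- rewrite /tor_boundaries -mulmxA gd' mulmxA [X in (X *m _ <= _)%MS]gP -mulmxA.
  exact: submxMl.
move=> v vZ; have vP : v *m tor_part F i j = v.
  apply/eqP; rewrite -sub_degpart.
  by clear -vZ; case: i v vZ => [|i] v //=; rewrite sub_capmx => /andP[].
have hB : (v *m const (h i) *m tor_diff F i <= tor_boundaries F i j)%MS.
  by rewrite -vP -(mulmxA v) [X in (v *m X *m _ <= _)%MS]hP mulmxA -mulmxA submxMl.
(* The homotopy writes [f i *m g i - 1%:M] as a sum of two terms: the first sends [v] to a boundary,
   the second (absent for [i = 0]) starts with the differential and kills the cycle [v]. *)
rewrite -mulmxA -[X in _ - X]mulmx1 -mulmxBr -map_mxM.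
have const1 r : 1%:M = const (1%:M : 'M[R]_r) by rewrite map_mx1.
case: i v {vP} hB vZ => [|i] v hB vZ.
  by rewrite const1 -map_mxB hE0 map_mxM mulmxA.
rewrite const1 -map_mxB hE map_mxD !map_mxM mulmxDr !mulmxA.
move: vZ; rewrite sub_capmx => /andP[_ /sub_kermxP ->].
by rewrite mul0mx addr0.
Qed.

Lemma betti_tor_dim (F : graded_free_resolution Mdeg) i j :
  graded_module Mdeg -> betti M Mdeg i j = tor_dim F i j.
Proof.
move=> gM; rewrite /betti; case: pselect => [ex|[]]; last by exists F.
by apply/anti_leq; rewrite !tor_dim_le.
Qed.

Lemma tor_dim_le_count (F : graded_free_resolution Mdeg) i j :
  (tor_dim F i j <= gcount (gcomplex_of F) i j)%N.
Proof.
apply: (leq_trans (leq_subr _ _)); rewrite -[X in (_ <= X)%N](rank_degpart k).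
by case: i => [|i] //=; apply/mxrankS/capmxSl.
Qed.

(** Without generators of degree [j] in the two neighbouring homological degrees, the degree [j]
    boundaries vanish and everything of degree [j] is a cycle. *)
Lemma tor_dim_count (F : graded_free_resolution Mdeg) i j :
  gcount (gcomplex_of F) i.+1 j = 0%N ->
  (forall i', i = i'.+1 -> gcount (gcomplex_of F) i' j = 0%N) ->
  tor_dim F i j = gcount (gcomplex_of F) i j.
Proof.
have P0 l : gcount (gcomplex_of F) l j = 0%N -> tor_part F l j = 0.
  by move=> c0; apply/eqP; rewrite -mxrank_eq0 -leqn0 -c0 -[X in (_ <= X)%N](rank_degpart k).
move=> cS cP; rewrite /tor_dim /tor_boundaries (P0 _ cS) mul0mx mxrank0 subn0.
rewrite -[RHS](rank_degpart k).
case: i cS cP => [|i] cS cP //=; apply/eqmx_rank/andP; split; first exact: capmxSl.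
rewrite sub_capmx submx_refl; apply/sub_kermxP.
by rewrite tor_diffP (P0 _ (cP i erefl)) mulmx0.
Qed.

End TorInvariance.

(** * Adjoining a generator to a resolved module *)

Section Horseshoe.
Variables (k : fieldType) (m : nat).
Local Notation R := {mpoly k[m]}.
Implicit Types (C K : gcomplex k m).

(* A resolution of an ideal [J], preceded by a free module of rank one in degree [e],
   resolves the quotient by [J]. *)
Section Cons.
Variables (C : gcomplex k m) (e : int) (u : 'I_(grank C 0) -> R^o).
Hypothesis u_homog : forall a, homogz (gdeg a - e) (u a).
Hypothesis u_exact : forall v, lincomb u v = 0 <-> exists w, v = w *m gdiff C 0.

Definition gcons_rank i := if i is i'.+1 then grank C i' else 1%N.

Definition gcons_deg i : 'I_(gcons_rank i) -> int :=
  match i with 0 => fun=> e | i'.+1 => @gdeg _ _ C i' end.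

Definition gcons_diff i : 'M[R]_(gcons_rank i.+1, gcons_rank i) :=
  match i with 0 => \col_a u a | i'.+1 => gdiff C i' end.

Lemma mulmx_gcons_diff0 (v : 'rV_(grank C 0)) : v *m gcons_diff 0 = (lincomb u v)%:M.
Proof.
apply/matrixP => a b; rewrite !ord1 !mxE eqxx mulr1n.
by apply: eq_bigr => c _; rewrite mxE.
Qed.

Definition gcons : gcomplex k m.
Proof.
exists gcons_rank gcons_deg gcons_diff.
  by case=> [|i] a b /=; [rewrite mxE; exact: u_homog | exact: gdiff_homog].
case=> [|i] v; last exact: gexact.
rewrite -u_exact mulmx_gcons_diff0; split=> [/matrixP/(_ 0 0)|->]; last by rewrite raddf0.
by rewrite !mxE eqxx mulr1n.
Defined.

End Cons.

Section Cone.
Variables C K : gcomplex k m.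
Variable f : forall i, 'M[R]_(grank K i.+1, grank C i).
Hypothesis f_homog : forall i, homogmx (@gdeg _ _ K i.+1) (@gdeg _ _ C i) (f i).
Hypothesis f_chain : forall i, f i.+1 *m gdiff C i = gdiff K i.+1 *m f i.

Definition gcone_deg i (a : 'I_(grank C i + grank K i)) : int :=
  match split a with inl b => gdeg b | inr c => gdeg c end.

Lemma gcone_degl i (a : 'I_(grank C i)) : gcone_deg (lshift _ a) = gdeg a.
Proof. by rewrite /gcone_deg (unsplitK (inl a)). Qed.

Lemma gcone_degr i (a : 'I_(grank K i)) : gcone_deg (rshift _ a) = gdeg a.
Proof. by rewrite /gcone_deg (unsplitK (inr a)). Qed.

(** A mapping cone, indexed so that [f] lowers the homological degree by one; the sign on [K] makes
    consecutive differentials compose to 0. *)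
Definition gcone_diff i := block_mx (gdiff C i) 0 (f i) (- gdiff K i).

Lemma gcone_diffE i (a : 'rV_(grank C i.+1)) (b : 'rV_(grank K i.+1)) :
  row_mx a b *m gcone_diff i = row_mx (a *m gdiff C i + b *m f i) (- (b *m gdiff K i)).
Proof. by rewrite mul_row_block mulmx0 add0r mulmxN. Qed.

Lemma gcone_homog i : homogmx (@gcone_deg i.+1) (@gcone_deg i) (gcone_diff i).
Proof.
move=> a b; case: (split_ordP a) => a' ->; case: (split_ordP b) => b' ->;
  rewrite ?gcone_degl ?gcone_degr ?block_mxEul ?block_mxEur ?block_mxEdl ?block_mxEdr.
- exact: gdiff_homog.
- by rewrite mxE; exact: homogz0.
- exact: f_homog.
by rewrite mxE; apply/homogzN/gdiff_homog.
Qed.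

Lemma gcone_exact i (v : 'rV_(grank C i.+1 + grank K i.+1)) :
  v *m gcone_diff i = 0 <-> exists w, v = w *m gcone_diff i.+1.
Proof.
rewrite -[v]hsubmxK; move: (lsubmx v) (rsubmx v) => {v} a b; split=> [|[w]].
  rewrite gcone_diffE -row_mx0 => /eq_row_mx[ab /eqP].
  rewrite oppr_eq0 => /eqP/gexact[c bE].
  (* Once [b] is written as the boundary of [c], the correction of [a] by the image of [c] under [f]
     is a cycle of [C]. *)
  have /gexact[d ad] : (a + c *m f i.+1) *m gdiff C i = 0.
    by rewrite mulmxDl -mulmxA f_chain mulmxA -bE.
  exists (row_mx d (- c)).
  by rewrite gcone_diffE !mulNmx -ad addrK opprK bE.
rewrite -[w]hsubmxK gcone_diffE => /eq_row_mx[-> ->].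
rewrite gcone_diffE !mulNmx opprK mulmxDl -!mulmxA !gdiffK f_chain !mulmx0.
by rewrite add0r subrr row_mx0.
Qed.

Definition gcone := GComplex gcone_homog gcone_exact.

Lemma gcount_gcone i j : gcount gcone i j = (gcount C i j + gcount K i j)%N.
Proof.
rewrite /gcount -!sum1_card big_split_ord /=; congr addn; apply: eq_bigl => a.
  by rewrite !inE gcone_degl.
by rewrite !inE gcone_degr.
Qed.

End Cone.

Definition adjoin (M : lmodType R) (N : M -> Prop) (x y : M) : Prop :=
  exists p : R, N (y - p *: x).

(* The quotient of [N + R x] by [N] is [R / J] shifted by [e]. *)
Lemma resolves_adjoin (M : lmodType R) (Mdeg : int -> M -> Prop) (C G : gcomplex k m)
    (N : M -> Prop) (J : R^o -> Prop) g u x e :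
  graded_module Mdeg -> resolves Mdeg C N g ->
  resolves (fun z => homogz z : R^o -> Prop) G J u ->
  Mdeg e x -> (forall p : R, N (p *: x) <-> J p) ->
  exists (C' : gcomplex k m) g', resolves Mdeg C' (adjoin N x) g' /\
    forall i j, gcount C' i j =
      (gcount C i j + if i is i'.+1 then gcount G i' (j - e)%R else (j == e))%N.
Proof.
move=> gM rC rG ex NJ; have [hg img kerg] := rC; have [hu imu keru] := rG.
pose G' := gshift e G.
have hu' (a : 'I_(grank G' 0)) : homogz (gdeg a - e) (u a) by rewrite addrK.
pose K := gcons hu' keru.
have hux a : Mdeg (gdeg a + e) (u a *: x) by apply: gM.1.
(* Each [u a *: x] lies in [N] because [u a] lies in [J]; its expression in the generators of [N] is
   the lowest component of the map whose cone is taken. *)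
have [a|f0 hf0 f0E] := resolves_lift gM rC hux.
  by apply/NJ/imu; exists (delta_mx 0 a); exact: lincomb_delta.
have [|f [fE hf cf]] := @chain_map_exists _ _ G' C f0 hf0.
  apply: (lincomb_lift rC) => [|a]; first exact: homogmxM (@gdiff_homog _ _ G' 0) hf0.
  have /(congr1 (fun p : R => p *: x)) := @lincomb_diff0 _ _ _ _ G J u a rG.
  rewrite row_mul lincombM scale0r scaler_suml => <-.
  by apply: eq_bigr => b _; rewrite -f0E scalerA.
have f0x b : lincomb g (b *m f0) = (lincomb u b : R) *: x.
  by rewrite lincombM scaler_suml; apply: eq_bigr => a _; rewrite -f0E scalerA.
pose C' := @gcone C K f hf (fun i => esym (cf i)).
pose g' (a : 'I_(grank C 0 + 1)) : M := if split a is inl b then g b else x.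
have g'E (v : 'rV_(grank C 0)) (c : 'rV_1) : lincomb g' (row_mx v c) = lincomb g v + c 0 0 *: x.
  rewrite /lincomb big_split_ord big_ord1; congr (_ + _).
    by apply: eq_bigr => a _; rewrite row_mxEl /g' (unsplitK (inl a)).
  by rewrite row_mxEr /g' (unsplitK (inr _)).
exists C', g'; split; last first.
  move=> i j; rewrite gcount_gcone; congr addn; case: i => [|i] /=.
    rewrite /gcount -sum1_card /= big_mkcond big_ord1 inE /= eq_sym.
    by case: eqP.
  by apply: eq_card => a; rewrite !inE /= [RHS]eq_sym subr_eq eq_sym.
split=> [a|y|v].
- case: (split_ordP a) => b ->; rewrite /g' /=.
    by rewrite gcone_degl (unsplitK (inl b)).
  by rewrite gcone_degr (unsplitK (inr b)).
- split=> [[p /img[v vE]]|[v]].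
    exists (row_mx v (const_mx p)); rewrite g'E vE mxE subrK //.
  rewrite -[v]hsubmxK g'E => <-; exists (rsubmx v 0 0); rewrite addrK.
  by apply/img; exists (lsubmx v).
rewrite -[v]hsubmxK; move: (lsubmx v) (rsubmx v) => {v} a t; rewrite g'E; split.
  move=> at0.
  (* A relation involving [x] puts the multiple [t 0 0 *: x] in [N], so its coefficient belongs to
     the colon ideal [J]. *)
  have /imu[c cE] : J (t 0 0).
    by apply/NJ/img; exists (- a); rewrite lincombN; apply/eqP; rewrite eqr_oppLR -addr_eq0 at0.
  have /kerg[d dE] : lincomb g (a + c *m f0) = 0.
    by rewrite lincombD f0x cE.
  exists (row_mx d (- c)).
  rewrite gcone_diffE /= mulNmx fE -dE addrK mulNmx opprK mulmx_gcons_diff0 cE.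
  by congr row_mx; apply/matrixP => b b'; rewrite !ord1 mxE eqxx mulr1n.
case=> w; rewrite -[w]hsubmxK gcone_diffE => /eq_row_mx[-> ->] /=.
rewrite fE mulmx_gcons_diff0 !mxE eqxx mulr1n scaleNr lincombD f0x.
have -> : lincomb g (lsubmx w *m gdiff C 0) = 0 by apply/kerg; exists (lsubmx w).
by rewrite add0r subrr.
Qed.

End Horseshoe.

(** * Linear quotients *)

Section MonomialIdeals.
Variables (k : fieldType) (m : nat).
Local Notation R := {mpoly k[m]}.
Implicit Types (p q : R) (u v : 'X_{1..m}) (s : {set 'I_m}).

Definition mnmsupp u : {set 'I_m} := [set w | u w != 0%N].

Definition sqfree s : 'X_{1..m} := [multinom nat_of_bool (w \in s) | w < m].

Lemma mnmsuppD u v : mnmsupp (u + v) = mnmsupp u :|: mnmsupp v.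
Proof. by apply/setP => w; rewrite !inE mnmDE addn_eq0 negb_and. Qed.

Lemma mnmsupp_sqfree s : mnmsupp (sqfree s) = s.
Proof. by apply/setP => w; rewrite inE mnmE; case: (w \in s). Qed.

Lemma mnmsupp1 w : mnmsupp U_(w) = [set w].
Proof. by apply/setP => x; rewrite !inE mnm1E [RHS]eq_sym; case: (w == x). Qed.

Lemma mdeg_sqfree s : mdeg (sqfree s) = #|s|.
Proof.
rewrite mdegE -sum1_card [RHS]big_mkcond; apply: eq_bigr => w _.
by rewrite mnmE; case: (w \in s).
Qed.

Lemma sqfree_le s u : (sqfree s <= u)%MM = (s \subset mnmsupp u).
Proof.
apply/mnm_lepP/subsetP => h w; last first.
  by rewrite mnmE; have := h w; rewrite inE; case: (w \in s) => // /(_ isT); rewrite lt0n.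
by move=> ws; rewrite inE -lt0n; apply: leq_trans (h w); rewrite mnmE ws.
Qed.

Lemma sqfreeE s : \prod_(w in s) 'X_w = 'X_[sqfree s] :> R.
Proof.
rewrite mpolyXE_id [LHS]big_mkcond; apply: eq_bigr => w _.
by rewrite mnmE; case: (w \in s); rewrite ?expr1.
Qed.

Definition suppin (P : 'X_{1..m} -> Prop) p : Prop := forall u, u \in msupp p -> P u.

Lemma suppin0 P : suppin P 0.
Proof. by move=> u; rewrite msupp0. Qed.

Lemma suppinD P p q : suppin P p -> suppin P q -> suppin P (p + q).
Proof.
by move=> hp hq u /msuppD_le; rewrite mem_cat => /orP[]; [exact: hp | exact: hq].
Qed.

Lemma suppinM P p q : (forall u v, P u -> P (v + u)%MM) -> suppin P p -> suppin P (q * p).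
Proof.
move=> Pup hp u /msuppM_le/allpairsP[[u1 u2] /= [_ u2p ->]]; exact/Pup/hp.
Qed.

Lemma suppinX P u : suppin P 'X_[u] <-> P u.
Proof.
split=> [h|Pu v]; first by apply: h; rewrite msuppX mem_head.
by rewrite msuppX inE => /eqP ->.
Qed.

Lemma suppinMX P u p : suppin P (p * 'X_[u]) <-> suppin (fun v => P (u + v)%MM) p.
Proof.
split=> h v; last first.
  by rewrite (perm_mem (msuppMX _ _)) => /mapP[v' /h Pv ->].
by move=> vp; apply: h; rewrite (perm_mem (msuppMX _ _)) map_f.
Qed.

Lemma scale_suppin (M : lmodType R) (N : M -> Prop) (P : 'X_{1..m} -> Prop) x p :
  N 0 -> (forall y z, N y -> N z -> N (y + z)) ->
  (forall (q : R) y, N y -> N (q *: y)) ->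
  (forall u, P u -> N (('X_[u] : R) *: x)) -> suppin P p -> N (p *: x).
Proof.
move=> N0 ND NZ NP hp; rewrite [p]mpolyE scaler_suml big_seq.
elim/big_ind: _ => // u /hp /NP Nu.
by rewrite -mul_mpolyC -scalerA; exact: NZ.
Qed.

(** The ideal generated by the variables in [W], described by the monomials that may occur in its
    elements. *)
Definition varideal (W : {set 'I_m}) : R^o -> Prop :=
  suppin (fun u => W :&: mnmsupp u != set0).

Lemma sr_idealP (D : {set {set 'I_m}}) p :
  p \in sr_ideal k D <->
  suppin (fun u => exists2 s, s \notin D & s \subset mnmsupp u) p.
Proof.
split.
  move=> /asboolP[c ->]; elim/big_ind: _ => [||s sD]; [exact: suppin0 | exact: suppinD |].
  rewrite sqfreeE; apply: suppinM.
    move=> u v [t tD tu]; exists t => //.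
    by rewrite mnmsuppD (subset_trans tu) ?subsetUr.
  by apply/suppinX; exists s; rewrite ?mnmsupp_sqfree.
move=> hp; have := @scale_suppin R^o (fun x => x \in sr_ideal k D) _ 1 p _ _ _ _ hp.
rewrite [_ *: _]mulr1; apply.
- exact: rpred0.
- by move=> y z; exact: rpredD.
- by move=> q y; exact: rpredZ.
move=> u [s sD su]; rewrite [_ *: _]mulr1; apply/asboolP.
exists (fun t => if t == s then 'X_[u - sqfree s] else 0).
rewrite (bigD1 s) //= eqxx sqfreeE big1 ?addr0; last first.
  by move=> t /andP[_ /negPf ->]; rewrite mul0r.
by rewrite -mpolyXD submK // sqfree_le.
Qed.

(** The generators are homogeneous, so it suffices to replace each coefficient by its component of
    degree [z - #|s|]. *)
Lemma sr_ideal_hcomp (D : {set {set 'I_m}}) z p :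
  p \in sr_ideal k D -> hcomp z p \in sr_ideal k D.
Proof.
move=> /asboolP[c ->]; apply/asboolP; exists (fun s => hcomp (z - #|s|%:Z) (c s)).
rewrite hcomp_sum; apply: eq_bigr => s _.
rewrite -[in LHS](subrK #|s|%:Z z) hcompM // sqfreeE.
by rewrite /= dhomogX; apply/eqP/mdeg_sqfree.
Qed.

End MonomialIdeals.

(** * Koszul resolutions and iterated adjunction *)

Section Koszul.
Variables (k : fieldType) (m : nat).
Local Notation R := {mpoly k[m]}.

Lemma graded_regular : graded_module (fun z => homogz z : R^o -> Prop).
Proof.
split=> [z w p x hp hx | z x r dg g v hg hx xE]; first exact: homogzM.
rewrite -{1}(hcomp_id hx) xE hcomp_sum; apply: eq_bigr => a _.
by rewrite -[in LHS](subrK (dg a) z) [_ *: _ in LHS]/(_ * _) (hcompM _ _ (hg a)).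
Qed.

Definition gzero : gcomplex k m.
Proof.
exists (fun=> 0%N) (fun _ _ => 0) (fun=> 0); first by move=> i [[]].
by move=> i v; rewrite mulmx0; split=> // _; exists 0; rewrite mulmx0 [v]thinmx0.
Defined.

Lemma resolves_zero (M : lmodType R) (Mdeg : int -> M -> Prop) :
  resolves Mdeg gzero (fun x => x = 0) (fun=> 0).
Proof.
split=> [[]//|x|v]; last first.
  split=> [_|_]; first by exists 0; rewrite [v]thinmx0 mul0mx.
  by rewrite /lincomb big_ord0.
by split=> [->|[v <-]]; [exists 0; rewrite /lincomb big_ord0 | rewrite /lincomb big_ord0].
Qed.

Lemma gcount_zero i j : gcount gzero i j = 0%N.
Proof. by apply: eq_card0 => -[]. Qed.

Lemma resolves_ext (M : lmodType R) (Mdeg : int -> M -> Prop) C (N N' : M -> Prop) g :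
  (forall x, N x <-> N' x) -> resolves Mdeg C N g -> resolves Mdeg C N' g.
Proof.
move=> NN' [hg im ker]; split=> // x; rewrite -NN'; exact: im.
Qed.

(** A variable [w] of [W] is adjoined to the ideal of [W :\ w]. The colon ideal is that same ideal,
    so the induction hypothesis serves twice and Pascal's rule gives the ranks. The index is [i.+1]
    because the ideal, not its quotient, is resolved. *)
Lemma koszul (W : {set 'I_m}) :
  exists C u, resolves (fun z => homogz z : R^o -> Prop) C (@varideal k m W) u /\
    forall i j, gcount C i j = ((j == i.+1) * 'C(#|W|, i.+1))%N.
Proof.
move: {2}#|W| (erefl #|W|) => n; elim: n W => [|n IHn] W Wn.
  have {Wn} -> := cards0_eq Wn; exists gzero, (fun=> 0); split; last first.
    by move=> i j; rewrite gcount_zero cards0 bin0n muln0.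
  apply: resolves_ext (resolves_zero _) => p; split=> [->|hp]; first exact: suppin0.
  apply/eqP; rewrite -msupp_eq0; case E: (msupp p) => [//|x r].
  by have := hp x; rewrite E mem_head set0I eqxx => /(_ isT).
have /card_gt0P[w wW] : (0 < #|W|)%N by rewrite Wn.
have W'n : #|W :\ w| = n by move: Wn; rewrite (cardsD1 w) wW => -[].
have [C [u [rC cC]]] := IHn _ W'n.
have hw : homogz 1 ('X_w : R) by rewrite /= dhomogX; apply/eqP/mdeg1.
have colon (p : R) : varideal (W :\ w) (p *: ('X_w : R^o)) <-> varideal (W :\ w) p.
  have W'w : (W :\ w) :&: [set w] = set0.
    by apply/setP => x; rewrite !inE; case: eqVneq; rewrite ?andbF.
  rewrite [_ *: _]/(_ * _); split=> [/suppinMX h v /h|h]; last (apply/suppinMX => v /h);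
    by rewrite mnmsuppD mnmsupp1 setIUr W'w set0U.
have [C' [u' [rC' cC']]] := resolves_adjoin graded_regular rC rC hw colon.
exists C', u'; split; last first.
  move=> i j; rewrite cC' cC Wn W'n; case: i => [|i]; first by rewrite !bin1 mulnS addnC.
  by rewrite cC W'n binS mulnDr; congr (_ + _ * _)%N; congr nat_of_bool; lia.
apply: resolves_ext rC' => p; split.
  move=> [q h]; rewrite -[p](subrK (q *: ('X_w : R^o))); apply: suppinD.
    by move=> v /h; apply: contra_neq => W0; apply/eqP; rewrite -subset0 -W0 setSI ?subD1set.
  apply/suppinMX => v _; rewrite mnmsuppD mnmsupp1; apply/set0Pn; exists w.
  by rewrite !inE eqxx wW.
(* The witness collects the terms of [p] divisible by [X_w], divided by it; every remaining term
   involves another variable of [W]. *)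
move=> hp; exists (\sum_(v <- msupp p | w \in mnmsupp v) p@_v *: 'X_[v - U_(w)]).
rewrite scaler_suml {1}[p]mpolyE (bigID (fun v => w \in mnmsupp v)) /=.
rewrite [X in _ - X](eq_bigr (fun v => p@_v *: 'X_[v])); last first.
  move=> v; rewrite inE => wv.
  by rewrite -[LHS]/((p@_v *: 'X_[v - U_(w)] : R) * 'X_w) -scalerAl -mpolyXD submK // lep1mP.
rewrite addrAC subrr add0r big_seq_cond.
elim/big_ind: _ => [||v /andP[/hp /set0Pn[x xWv] wv]]; [exact: suppin0 | exact: suppinD |].
move=> v' /msuppZ_le; rewrite msuppX inE => /eqP ->; apply/set0Pn; exists x.
rewrite !inE in xWv wv *; case/andP: xWv => -> xv; rewrite xv !andbT.
by apply: contraNneq wv => <-.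
Qed.

Section LinearQuotients.
Variables (M : lmodType R) (Mdeg : int -> M -> Prop).
Variables (T : eqType) (g : T -> M) (e : T -> int) (W : T -> {set 'I_m}).

(* The head of the list is adjoined last. *)
Fixpoint gspan (s : seq T) : M -> Prop :=
  if s is t :: s' then adjoin (gspan s') (g t) else fun x => x = 0.

Lemma gspan0 s : gspan s 0.
Proof. by elim: s => //= t s IH; exists 0; rewrite scale0r subr0. Qed.

Lemma gspanD s x y : gspan s x -> gspan s y -> gspan s (x + y).
Proof.
elim: s x y => /= [|t s IH] x y; first by move=> -> ->; rewrite addr0.
by move=> [p hp] [q hq]; exists (p + q); rewrite scalerDl opprD addrACA; exact: IH.
Qed.

Lemma gspanZ s (p : R) x : gspan s x -> gspan s (p *: x).
Proof.
elim: s x => /= [|t s IH] x; first by move=> ->; rewrite scaler0.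
by move=> [q hq]; exists (p * q); rewrite -scalerA -scalerBr; exact: IH.
Qed.

Lemma gspan_gen s t : t \in s -> gspan s (g t).
Proof.
elim: s => //= t' s IH; rewrite inE => /predU1P[->|/IH ts].
  by exists 1; rewrite scale1r subrr; exact: gspan0.
by exists 0; rewrite scale0r subr0.
Qed.

Lemma gspan_sub s (N : M -> Prop) : N 0 -> (forall x y, N x -> N y -> N (x + y)) ->
  (forall (p : R) x, N x -> N (p *: x)) -> (forall t, t \in s -> N (g t)) ->
  forall x, gspan s x -> N x.
Proof.
move=> N0 ND NZ; elim: s => /= [|t s IH] Ng x; first by move=> ->.
move=> [p hp]; rewrite -[x](subrK (p *: g t)); apply: ND.
  by apply: IH => // t' t's; apply: Ng; rewrite inE t's orbT.
by apply: NZ; apply: Ng; rewrite mem_head.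
Qed.

Lemma linear_quotients s : graded_module Mdeg -> (forall t, t \in s -> Mdeg (e t) (g t)) ->
  (forall s1 t s2, s = s1 ++ t :: s2 ->
     forall p : R, gspan s2 (p *: g t) <-> varideal (W t) p) ->
  exists C h, resolves Mdeg C (gspan s) h /\
    forall i j, gcount C i j = (\sum_(t <- s) (j == (e t + i%:Z)%R) * 'C(#|W t|, i))%N.
Proof.
move=> gM; elim: s => [|t s IH] hg colon /=.
  by exists gzero, (fun=> 0); split=> [|i j]; [exact: resolves_zero | rewrite gcount_zero big_nil].
have [||C [h [rC cC]]] := IH.
- by move=> t' t's; apply: hg; rewrite inE t's orbT.
- by move=> s1 t' s2 sE; apply: (colon (t :: s1)); rewrite sE.
have [G [u [rG cG]]] := koszul (W t).
have [C' [h' [rC' cC']]] := resolves_adjoin gM rC rG (hg t (mem_head _ _)) (colon [::] _ _ erefl).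
exists C', h'; split=> // i j; rewrite cC' cC big_cons addnC; congr addn.
case: i => [|i]; first by rewrite bin0 muln1 addr0.
rewrite cG; congr (_ * _)%N; congr nat_of_bool; lia.
Qed.

End LinearQuotients.

End Koszul.

(** * Projective dimension *)

Section ProjectiveDimension.
Variables (k : fieldType) (m : nat).
Local Notation R := {mpoly k[m]}.

Lemma projective_rV r : projective 'rV[R]_r.
Proof.
move=> N N' g f g_surj.
have /choice[x hx] : forall a : 'I_r, exists x, g x = f (delta_mx 0 a) by move=> a; exact: g_surj.
exists (lincomb x) => v; rewrite [in RHS](row_sum_delta v) /lincomb !linear_sum.
by apply: eq_bigr => a _; rewrite !linearZ /= hx.
Qed.

Section ImageSubmodule.
Variables (r c : nat) (A : 'M[R]_(r, c)).

Definition row_image : {pred 'rV[R]_c} := fun v => `[< exists w, v = w *m A >].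

Lemma row_image_submod_closed : submod_closed row_image.
Proof.
split=> [|p u v /asboolP[x ->] /asboolP[y ->]]; apply/asboolP.
  by exists 0; rewrite mul0mx.
by exists (p *: x + y); rewrite mulmxDl scalemxAl.
Qed.

HB.instance Definition _ := GRing.isSubmodClosed.Build R 'rV[R]_c row_image
  row_image_submod_closed.

Lemma mem_row_image w : w *m A \in row_image.
Proof. by apply/asboolP; exists w. Qed.

Definition to_row_image (w : 'rV[R]_r) : submod row_image := Submod (mem_row_image w).

Lemma to_row_image_is_linear : linear to_row_image.
Proof.
by move=> p u v; apply: val_inj; rewrite linearP /= mulmxDl scalemxAl.
Qed.

HB.instance Definition _ := GRing.isLinear.Build R 'rV[R]_r (submod row_image) *:%R
  to_row_image to_row_image_is_linear.

(** Projectivity lifts along surjections, so [h] is first corestricted to the image of [A], onto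
    which multiplication by [A] is surjective. *)
Lemma projective_lift (P : lmodType R) (h : {linear P -> 'rV[R]_c}) :
  projective P -> (forall z, exists w, h z = w *m A) ->
  exists h' : {linear P -> 'rV[R]_r}, forall z, h z = h' z *m A.
Proof.
move=> projP hA; have hS z : h z \in row_image by exact/asboolP/hA.
pose hS' z : submod row_image := Submod (hS z).
have hS'_lin : linear hS' by move=> p u v; apply: val_inj; rewrite [RHS]linearP /= linearP.
pose hS'_l : {linear P -> submod row_image} :=
  HB.pack hS' (GRing.isLinear.Build R P (submod row_image) *:%R hS' hS'_lin).
have [|h' h'E] := projP _ _ to_row_image hS'_l.
  by case=> v v_im; have /asboolP[w vE] := v_im; exists w; apply: val_inj.
by exists h' => z; have /(congr1 val) := h'E z.
Qed.

End ImageSubmodule.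

Variables (M : lmodType R) (Mdeg : int -> M -> Prop).
Variable F : graded_free_resolution Mdeg.
Local Notation d i := (gres_diff F i).

Lemma proj_dim_le_resolution p :
  (forall i, (p < i)%N -> gres_rank F i = 0%N) -> proj_dim_le M p.
Proof.
move=> rank0.
have surj (x : M) : exists v, lincomb (@gres_aug _ _ _ _ F) v = x by exact: gres_surj.
have exact0 v : lincomb (@gres_aug _ _ _ _ F) v = 0 <-> exists w, mulmxr (d 0) w = v.
  by split=> [/gres_exact0[w ->]|[w <-]]; [exists w | apply/gres_exact0; exists w].
have exact i (v : 'rV_(gres_rank F i.+1)) : mulmxr (d i) v = 0 <-> exists w, mulmxr (d i.+1) w = v.
  by split=> [/= /gres_exact[w ->]|[w <-] /=]; [exists w | apply/gres_exact; exists w].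
exists (@ProjResolution R M (fun i => 'rV[R]_(gres_rank F i)) (fun i => mulmxr (d i))
  (lincomb (@gres_aug _ _ _ _ F)) (fun i => @projective_rV _) surj exact0 exact).
by move=> i /rank0 i0 /= x; apply/matrixP => a b; have := ltn_ord b; rewrite {2}i0.
Qed.

Section LowerBound.
Variable P : proj_resolution M.

Lemma free_to_projective : exists f : forall i, 'I_(gres_rank F i) -> pres_mod P i,
  (forall a, pres_aug P (f 0%N a) = gres_aug a) /\
  forall i a, pres_diff P i (f i.+1 a) = lincomb (f i) (row a (d i)).
Proof.
have /choice[f0 f0E] : forall a : 'I_(gres_rank F 0), exists x, pres_aug P x = gres_aug a.
  by move=> a; exact: pres_surj.
have lin_lincomb (V V' : lmodType R) (h : {linear V -> V'}) r (x : 'I_r -> V) v :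
    h (lincomb x v) = lincomb (h \o x) v.
  by rewrite /lincomb linear_sum; apply: eq_bigr => a _; rewrite linearZ.
pose Q i (x : 'I_(gres_rank F i) -> pres_mod P i) :=
  forall a, exists y, pres_diff P i y = lincomb x (row a (d i)).
pose S i (x : 'I_(gres_rank F i) -> pres_mod P i) y :=
  forall a, pres_diff P i (y a) = lincomb x (row a (d i)).
have [||f [fE _ fS]] := @dependent_choice _ Q S f0.
- move=> a; apply/pres_exact0; rewrite lin_lincomb.
  rewrite -[RHS](@lincomb_diff0 _ _ _ _ (gcomplex_of F) _ _ a (gcomplex_of_resolves F)).
  by apply: eq_bigr => b _; rewrite /= f0E.
- move=> i x /choice[y yE]; exists y => // a; apply/pres_exact; rewrite lin_lincomb.
  transitivity (lincomb x (row a (d i.+1) *m d i)).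
    by rewrite lincombM; apply: eq_bigr => b _; rewrite /= yE.
  by rewrite -row_mul (gdiffK (gcomplex_of F)) row0 linear0.
by exists f; split=> // a; rewrite fE.
Qed.

Lemma projective_to_free :
  exists g : forall i, {linear pres_mod P i -> 'rV[R]_(gres_rank F i)},
  (forall z, lincomb (@gres_aug _ _ _ _ F) (g 0%N z) = pres_aug P z) /\
  forall i z, g i (pres_diff P i z) = g i.+1 z *m d i.
Proof.
have [|g0 g0E] := @pres_proj _ _ P 0 _ _ (lincomb (@gres_aug _ _ _ _ F)) (pres_aug P).
  exact: gres_surj.
pose Q i (x : {linear pres_mod P i -> 'rV[R]_(gres_rank F i)}) :=
  forall z, exists w, x (pres_diff P i z) = w *m d i.
pose S i (x : {linear pres_mod P i -> 'rV[R]_(gres_rank F i)})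
    (y : {linear pres_mod P i.+1 -> 'rV[R]_(gres_rank F i.+1)}) :=
  forall z, x (pres_diff P i z) = y z *m d i.
have [||g [gE _ gS]] := @dependent_choice _ Q S g0.
- move=> z; apply/gres_exact0; rewrite -/(lincomb _ _) g0E; apply/pres_exact0.
  by exists z.
- move=> i x hx.
  have [y yE] := @projective_lift _ _ _ _ (x \o pres_diff P i) (@pres_proj _ _ P _) hx.
  exists y => // z; apply/gres_exact; rewrite -yE /=.
  have -> : pres_diff P i (pres_diff P i.+1 z) = 0 by apply/pres_exact; exists z.
  by rewrite linear0.
by exists g; split=> // a; rewrite gE g0E.
Qed.

End LowerBound.

(* The identity of the minimal resolution [F] is homotopic to a map through [P]; if
   [P] vanishes in degree [p], then taking constant coefficients gives [1 = 0]. *)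
Lemma proj_dim_ge_resolution p q : graded_module Mdeg ->
  (forall i, map_mx (mcoeff 0%MM) (d i) = 0) -> (0 < gres_rank F p)%N ->
  proj_dim_le M q -> (p <= q)%N.
Proof.
move=> gM minF rank_gt0 [P P0]; rewrite leqNgt; apply/negP => qp.
have [f [f0 fd]] := free_to_projective P; have [g [g0 gd]] := projective_to_free P.
pose t i : 'M[R]_(gres_rank F i) := \matrix_a g i (f i a).
(* [P] carries no grading, so the composite [t] through [P] need not preserve degrees. Its
   degree-preserving component is still a chain map over the identity, and vanishes wherever [P]
   does. *)
pose c i := hcompmx (@gres_deg _ _ _ _ F i) (@gres_deg _ _ _ _ F i) (t i).
have rF := gcomplex_of_resolves F.
have [|h [_ _ hE]] := @comparison_homotopy _ _ _ _ (gcomplex_of F) _ _ c rF.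
  split=> [i|a|i]; first exact: hcompmx_homog.
    have aE : gres_aug a = \sum_b t 0%N a b *: gres_aug b.
      by rewrite -f0 -g0; apply: eq_bigr => b _; rewrite mxE.
    rewrite [RHS](gM.2 _ _ _ _ _ _ (@gres_aug_homog _ _ _ _ F) (gres_aug_homog a) aE).
    by apply: eq_bigr => b _; rewrite !mxE.
  rewrite -(hcompmxMl _ _ (@gres_diff_homog _ _ _ _ F i)).
  rewrite -(hcompmxM _ _ (@gres_diff_homog _ _ _ _ F i)).
  congr hcompmx; apply/row_matrixP => a; rewrite !row_mul rowK -gd fd mulmx_sum_row.
  by rewrite /lincomb linear_sum; apply: eq_bigr => b _; rewrite linearZ rowK.
case: p rank_gt0 qp => // p rank_gt0 qp.
have c0 : c p.+1 = 0.
  apply/matrixP => a b; rewrite !mxE (P0 _ qp (f _ a)) linear0 mxE; exact: hcomp0.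
have /(congr1 (map_mx (mcoeff 0%MM))) := hE p.
rewrite c0 sub0r map_mxD !map_mxM /= !minF mulmx0 mul0mx addr0.
move/matrixP => /(_ (Ordinal rank_gt0) (Ordinal rank_gt0)).
by rewrite !mxE eqxx mcoeffN mcoeff1 eqxx => /eqP; rewrite oppr_eq0 oner_eq0.
Qed.

End ProjectiveDimension.

(** * The two resolutions *)

Section GradedModules.
Variables (k : fieldType) (m : nat) (D : {set {set 'I_m}}).
Local Notation R := {mpoly k[m]}.
Local Notation I := (sr_ideal k D).
Local Notation pi := (quotmod_proj I).

Lemma quotmod_projZ (p q : R) : pi (p * q) = p *: pi q.
Proof. by symmetry; exact: quotmod_scaleE. Qed.

Lemma quotmod_proj0 : pi 0 = 0.
Proof. by rewrite -[0 in LHS](mul0r 0) quotmod_projZ scale0r. Qed.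

Lemma quotmod_proj_sum (T : Type) (r : seq T) (P : pred T) (f : T -> R) :
  pi (\sum_(i <- r | P i) f i) = \sum_(i <- r | P i) pi (f i).
Proof. exact: (big_morph _ (quotmod_projD I) quotmod_proj0). Qed.

Lemma graded_submod : graded_module (submod_deg I).
Proof.
have [homM homC] := graded_regular k m.
split=> [z w p x hp hx | z x r dg g v hg hx xE]; first exact: homM.
apply: val_inj; rewrite linear_sum [LHS](homC z (\val x) r dg (val \o g) v hg hx).
  by apply: eq_bigr => a _; rewrite [RHS]linearZ.
by rewrite xE linear_sum; apply: eq_bigr => a _; rewrite [LHS]linearZ.
Qed.

(** The expression is lifted to homogeneous representatives; the error lies in [I], and so does its
    component of degree [z]. *)
Lemma graded_quotmod : graded_module (quotmod_deg I).
Proof.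
have [homM homC] := graded_regular k m.
split=> [z w p _ hp [q hq <-] | z x r dg g v hg [p hp <-] xE].
  by exists (p * q); [exact: homM | exact: quotmod_projZ].
have /choice[q hq] : forall a, exists q, homogz (dg a) q /\ pi q = g a.
  by move=> a; have [q] := hg a; exists q.
rewrite [RHS](eq_bigr (fun a => pi (hcomp (z - dg a) (v a) * q a))); last first.
  by move=> a _; rewrite quotmod_projZ (hq a).2.
rewrite -quotmod_proj_sum; apply/quotmod_projP.
rewrite -[p](hcomp_id hp) (eq_bigr (fun a => hcomp z (v a * q a))); last first.
  by move=> a _; rewrite -(hcompM _ _ (hq a).1) subrK.
rewrite -hcomp_sum -hcompB; apply: sr_ideal_hcomp; apply/quotmod_projP.
rewrite xE quotmod_proj_sum; apply: eq_bigr => a _.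
by rewrite quotmod_projZ (hq a).2.
Qed.

End GradedModules.

Lemma resolution_of_resolves (k : fieldType) (m : nat) (M : lmodType {mpoly k[m]})
    (Mdeg : int -> M -> Prop) (C : gcomplex k m) (N : M -> Prop) g :
  resolves Mdeg C N g -> (forall x, N x) ->
  exists F : graded_free_resolution Mdeg,
    forall i j, gcount (gcomplex_of F) i j = gcount C i j.
Proof.
move=> [hg im ker] Nx.
have surj x : exists v, lincomb g v = x by apply/im.
by exists (GradedFreeResolution (@gdiff_homog _ _ C) hg surj ker (@gexact _ _ C)).
Qed.

(** Here [s2] holds what is adjoined before [t]: every element of smaller key, and possibly others
    of equal key. *)
Lemma sorted_split (T : eqType) (key : T -> nat) (r s1 s2 : seq T) t : uniq r ->
  sort (fun x y => (key y <= key x)%N) r = s1 ++ t :: s2 ->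
  [/\ forall x, x \in s2 -> x \in r, forall x, x \in s2 -> (key x <= key t)%N,
      t \notin s2, t \in r & forall x, x \in r -> (key x < key t)%N -> x \in s2].
Proof.
move=> r_uniq; set le := (fun x y => _) => rE.
have le_total : total le by move=> x y; exact: leq_total.
have le_trans : transitive le by move=> x y z xy yz; exact: leq_trans yz xy.
have : pairwise le (s1 ++ t :: s2).
  by rewrite -rE -sorted_pairwise // sort_sorted.
rewrite pairwise_cat /= => /and4P[/allrelP s1_le _ /allP t_le _].
have : uniq (s1 ++ t :: s2) by rewrite -rE sort_uniq.
rewrite cat_uniq /= => /and4P[_ _ tNs2 _].
have memr x : (x \in r) = [|| x \in s1, x == t | x \in s2].
  by rewrite -(mem_sort le) rE mem_cat inE.
split=> // [x xs2||x]; [by rewrite memr xs2 !orbT | by rewrite memr eqxx orbT |].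
rewrite memr => /or3P[xs1|/eqP ->|//]; last by rewrite ltnn.
by have := s1_le _ t xs1 (mem_head _ _); rewrite /le ltnNge => ->.
Qed.

(** * Facets of the coloured complex and their complements *)

Section ColouredComplex.
Variables (k : fieldType) (n s : nat) (D : {set {set 'I_n}}) (chi : 'I_s -> {set 'I_n}).
Hypotheses (hD : simplicial_complex D) (hchi : colouring D chi).
Local Notation R := {mpoly k[n + s]}.
Local Notation Dchi := (coloured_complex D chi).
Implicit Types (t : {set 'I_n}) (S : {set 'I_(n + s)}).

Definition xpart S : {set 'I_n} := [set v | lshift s v \in S].
Definition ypart S : {set 'I_s} := [set j | rshift n j \in S].
Definition xset t : {set 'I_(n + s)} := [set lshift s v | v in t].

Definition coface t : {set 'I_(n + s)} :=
  [set z | match split z with inl v => v \notin t | inr j => t :&: chi j != set0 end].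

Lemma mem_xset t v : (lshift s v \in xset t) = (v \in t).
Proof. by rewrite mem_imset //; exact: lshift_inj. Qed.

Lemma mem_xset_r t j : (rshift n j \in xset t) = false.
Proof. by apply/imsetP => -[v _ /eqP]; rewrite eq_rlshift. Qed.

Lemma coface_l t v : (lshift s v \in coface t) = (v \notin t).
Proof. by rewrite inE (unsplitK (inl v)). Qed.

Lemma coface_r t j : (rshift n j \in coface t) = (t :&: chi j != set0).
Proof. by rewrite inE (unsplitK (inr j)). Qed.

Lemma coloured_complexP S :
  reflect (xpart S \in D /\ forall j, j \in ypart S -> xpart S :&: chi j = set0)
    (S \in Dchi).
Proof.
apply: (iffP idP) => [/imset2P[sg ta sgD]|[SD Sj]].
  rewrite !inE => /forallP ta_chi ->.
  have -> : xpart (xset sg :|: [set rshift n j | j in ta]) = sg.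
    apply/setP => v; rewrite inE in_setU mem_xset; case: (v \in sg) => //=.
    by apply/imsetP => -[j _ /eqP]; rewrite eq_lrshift.
  split=> // j; rewrite inE in_setU mem_xset_r mem_imset; last exact: rshift_inj.
  by move=> /= jta; apply/eqP; have := ta_chi j; rewrite jta.
apply/imset2P; exists (xpart S) (ypart S) => //.
  by rewrite !inE; apply/forallP => j; apply/implyP => /Sj ->.
apply/setP => z; rewrite in_setU; case: (split_ordP z) => a ->.
  rewrite mem_imset ?inE; last exact: lshift_inj.
  case: (_ \in S) => //=; apply/esym/imsetP => -[j _ /eqP]; by rewrite eq_lrshift.
by rewrite mem_xset_r mem_imset ?inE //; exact: rshift_inj.
Qed.

(** A colouring constrains facets, and every face extends to one. *)
Lemma face_colour t j : t \in D -> (#|t :&: chi j| <= 1)%N.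
Proof.
move=> tD; have [F /maxsetP[FD Fmax] tF] := maxset_exists (P := mem D) tD.
have [_ _ /(_ F j) h] := hchi; apply: leq_trans (subset_leq_card (setSI _ tF)) (h _).
by split=> // G GD FG; exact: Fmax.
Qed.

(** The vertices of [t] have distinct colours, so the [#|t|] missing [x] vertices are balanced by
    the [#|t|] colours that [t] meets. *)
Lemma card_coface t : t \in D -> #|coface t| = n.
Proof.
move=> tD; have [cover disj _] := hchi.
rewrite -sum1_card big_split_ord /=.
rewrite (eq_bigl (fun v => v \in ~: t)); last by move=> v; rewrite coface_l in_setC.
rewrite [X in (_ + X)%N](eq_bigl (fun j => t :&: chi j != set0)); last first.
  by move=> j; rewrite coface_r.
have colE : (\sum_(j | t :&: chi j != set0) 1 = #|t|)%N.
  transitivity (\sum_j #|t :&: chi j|)%N.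
    rewrite big_mkcond; apply: eq_bigr => j _.
    have := face_colour j tD; rewrite -cards_eq0; by case: #|_| => [|[]].
  rewrite -sum1_card (eq_bigr (fun j => \sum_(v in t) (v \in chi j : nat)))%N; last first.
    move=> j _; rewrite -sum1_card big_mkcond [RHS]big_mkcond.
    by apply: eq_bigr => v _; rewrite inE; case: (v \in t); case: (v \in chi j).
  rewrite exchange_big; apply: eq_bigr => v _.
  have /bigcupP[j _ vj] : v \in \bigcup_j chi j by rewrite cover inE.
  rewrite (bigD1 j) //= vj big1 // => j' ne.
  by have := disjointFl (disj _ _ ne) vj => ->.
by rewrite colE sum1_card addnC cardsC card_ord.
Qed.

(** * Linear resolution of the ideal of the Alexander dual *)

Section DualIdeal.
Local Notation I := (sr_ideal k (alexander_dual Dchi)).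

(** Defined for every [t] with default 0; for a face the monomial does lie in the ideal. *)
Definition dual_gen t : submod I := insubd 0 ('X_[sqfree (coface t)] : R^o).

Lemma val_dual_gen t : t \in D -> val (dual_gen t) = 'X_[sqfree (coface t)].
Proof.
move=> tD; rewrite val_insubd ifT //; apply/sr_idealP/suppinX.
exists (coface t); last by rewrite mnmsupp_sqfree.
apply/imsetP => -[S]; rewrite inE => SD tE; case/negP: SD; apply/coloured_complexP.
have SE z : (z \in S) = (z \notin coface t) by rewrite tE in_setC negbK.
have -> : xpart S = t by apply/setP => v; rewrite inE SE coface_l negbK.
by split=> // j; rewrite inE SE coface_r negbK => /eqP.
Qed.

Lemma val_scale_dual_gen t (p : R) :
  t \in D -> (val (p *: dual_gen t) : R) = p * 'X_[sqfree (coface t)].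
Proof. by move=> tD; rewrite -(val_dual_gen tD). Qed.

Lemma dual_gen_deg t : t \in D -> submod_deg I n (dual_gen t).
Proof.
move=> tD; rewrite /submod_deg -/(val _) val_dual_gen //= dhomogX; apply/eqP.
by rewrite -[RHS](card_coface tD); exact: mdeg_sqfree.
Qed.

Lemma dual_colon (r1 r2 : seq {set 'I_n}) t (p : R) :
  sort (fun x y : {set 'I_n} => #|y| <= #|x|)%N (enum D) = r1 ++ t :: r2 ->
  gspan dual_gen r2 (p *: dual_gen t) <-> varideal (xset t) p.
Proof.
move=> /(sorted_split (enum_uniq _))[r2D r2le tNr2 tD ltr2].
rewrite !mem_enum in r2D tD ltr2.
split=> [|hp].
  have {}r2D t' : t' \in r2 -> t' \in D by move/r2D; rewrite mem_enum.
  pose Q u := exists2 t', t' \in r2 & coface t' \subset mnmsupp u.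
  have Qup u v : Q u -> Q (v + u)%MM.
    by move=> [t' t'r tu]; exists t' => //; rewrite mnmsuppD subsetU ?tu ?orbT.
  move/(gspan_sub (N := fun x : submod I => suppin Q (val x : R))) => hN.
  have : suppin Q (val (p *: dual_gen t)).
    apply: hN => [|x y hx hy|q x hx|t' t'r2]; [exact: suppin0|exact: suppinD|exact: suppinM|].
    rewrite val_dual_gen ?r2D //; apply/suppinX.
    by exists t' => //; rewrite mnmsupp_sqfree.
  rewrite val_scale_dual_gen // => /suppinMX h v /h[t' t'r2].
  rewrite mnmsuppD mnmsupp_sqfree => t'v.
  (* As [t'] differs from [t] and is no larger, some [w] in [t] is not in [t']: its variable divides
     the generator of [t'] but not that of [t], hence divides [v]. *)
  have /subsetPn[w wt wNt'] : ~~ (t \subset t').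
    by apply: contraNN tNr2 => tt'; have /eqP -> : t == t' by rewrite eqEcard tt' r2le.
  apply/set0Pn; exists (lshift s w); rewrite inE mem_xset wt /=.
  have := subsetP t'v (lshift s w); rewrite coface_l wNt' => /(_ isT).
  by rewrite in_setU coface_l wt.
apply: scale_suppin hp => [|x y|q x|u]; [exact: gspan0|exact: gspanD|exact: gspanZ|].
case/set0Pn => z; rewrite inE => /andP[/imsetP[v vt ->] vu].
have t'D : t :\ v \in D by apply: hD.2 tD _; exact: subD1set.
have -> : ('X_[u] : R) *: dual_gen t =
    ('X_[u + sqfree (coface t) - sqfree (coface (t :\ v))] : R) *: dual_gen (t :\ v).
  apply: val_inj; rewrite [LHS]val_scale_dual_gen // [RHS]val_scale_dual_gen // -!mpolyXD submK //.
  rewrite sqfree_le mnmsuppD mnmsupp_sqfree; apply/subsetP => z'.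
  case: (split_ordP z') => a ->; rewrite in_setU ?coface_l ?coface_r.
    rewrite inE in vu; rewrite !inE negb_and negbK.
    by case/orP => [/eqP ->|->]; rewrite ?vu ?orbT.
  move=> h; apply/orP; right; apply: contra_neq h => h; apply/eqP.
  by rewrite -subset0 -h setSI ?subD1set.
apply/gspanZ/gspan_gen/ltr2; first by rewrite mem_enum.
by rewrite [X in (_ < X)%N](cardsD1 v) vt.
Qed.

Lemma dual_gspan (r : seq {set 'I_n}) x :
  (forall t, t \in D -> t \in r) -> gspan dual_gen r x.
Proof.
move=> Dr; have := valP x => /sr_idealP hx.
pose N (p : R^o) := exists2 y : submod I, (val y : R) = p & gspan dual_gen r y.
have [y yE gy] : N ((val x : R) *: (1 : R^o)).
  apply: scale_suppin hx => [|_ _ [a <- ha] [b <- hb]|q _ [a <- ha]|u [S SD Su]].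
  - by exists 0; last exact: gspan0.
  - by exists (a + b); last exact: gspanD.
  - by exists (q *: a); last exact: gspanZ.
  have /coloured_complexP[tD Sj] : ~: S \in Dchi.
    by apply: contraNT SD => SD; apply/imsetP; exists (~: S); rewrite ?inE // setCK.
  pose t := xpart (~: S).
  (* A generator of the ideal comes from the complement [S] of a face; the [x] part [t] of that face
     gives a generator dividing it. *)
  have tS : coface t \subset S.
    apply/subsetP => z; case: (split_ordP z) => a ->.
      by rewrite coface_l inE in_setC negbK.
    by rewrite coface_r; apply: contraNT => aS; apply/eqP/Sj; rewrite inE in_setC.
  exists (('X_[u - sqfree (coface t)] : R) *: dual_gen t).
    rewrite val_scale_dual_gen // -mpolyXD submK ?sqfree_le ?(subset_trans tS) //.
    by rewrite [RHS]mulr1.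
  exact/gspanZ/gspan_gen/Dr.
have <- // : y = x by apply: val_inj; rewrite yE [LHS]mulr1.
Qed.

Lemma dual_resolution :
  exists F : graded_free_resolution (submod_deg I), forall i j,
    gcount (gcomplex_of F) i j
      = (\sum_(t in D) (j == (n%:Z + i%:Z)%R) * 'C(#|t|, i))%N.
Proof.
pose r := sort (fun x y : {set 'I_n} => #|y| <= #|x|)%N (enum D).
have rD t : (t \in r) = (t \in D) by rewrite mem_sort mem_enum.
have [||C [h [rC cC]]] :=
  @linear_quotients k _ _ _ _ dual_gen (fun=> n%:Z) xset r
    (@graded_submod k _ (alexander_dual Dchi)).
- by move=> t; rewrite rD; exact: dual_gen_deg.
- by move=> r1 t r2 /dual_colon.
have [x|F cF] := resolution_of_resolves rC; first by apply: dual_gspan => t; rewrite rD.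
exists F => i j; rewrite cF cC (perm_big (enum D)) ?perm_sort // big_enum.
by apply: eq_bigr => t _; rewrite card_imset //; exact: lshift_inj.
Qed.

End DualIdeal.

(** * Resolution of the face ring *)

Section FaceRing.
Local Notation I := (sr_ideal k Dchi).
Local Notation pi := (quotmod_proj I).

Definition face_gen t : quotmod I := pi 'X_[sqfree (xset t)].

Lemma face_gen_deg t : quotmod_deg I #|t| (face_gen t).
Proof.
exists 'X_[sqfree (xset t)] => //=; rewrite dhomogX; apply/eqP.
rewrite -(card_imset (mem t) (@lshift_inj n s)); exact: mdeg_sqfree.
Qed.

Lemma scale_face_gen t (p : R) : p *: face_gen t = pi (p * 'X_[sqfree (xset t)]).
Proof. by rewrite quotmod_projZ. Qed.

Lemma quotmod_proj_eq0 (p : R) : pi p = 0 <-> p \in I.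
Proof. by rewrite -(quotmod_proj0 k Dchi) quotmod_projP subr0. Qed.

Lemma nonface_scale_face_gen S t u :
  S \notin Dchi -> S \subset mnmsupp u :|: xset t -> ('X_[u] : R) *: face_gen t = 0.
Proof.
move=> SD Su; rewrite scale_face_gen -mpolyXD; apply/quotmod_proj_eq0/sr_idealP/suppinX.
by exists S => //; rewrite mnmsuppD mnmsupp_sqfree.
Qed.

Lemma face_colon (r1 r2 : seq {set 'I_n}) t (p : R) :
  sort (fun x y : {set 'I_n} => #|~: y| <= #|~: x|)%N (enum D) = r1 ++ t :: r2 ->
  gspan face_gen r2 (p *: face_gen t) <-> varideal (coface t) p.
Proof.
move=> /(sorted_split (enum_uniq _))[r2D r2le tNr2 tD ltr2].
rewrite !mem_enum in r2D tD ltr2.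
split=> [|hp].
  (* Working with representatives, a monomial is allowed if a previously adjoined generator divides
     it or if it already lies in [I]. *)
  pose Q u := (exists2 t', t' \in r2 & xset t' \subset mnmsupp u) \/
              (exists2 S, S \notin Dchi & S \subset mnmsupp u).
  have Qup u v : Q u -> Q (v + u)%MM.
    by case=> -[t' t'r tu]; [left | right]; exists t' => //; rewrite mnmsuppD subsetU ?tu ?orbT.
  move/(gspan_sub (N := fun x => exists2 a : R, pi a = x & suppin Q a)) => hN.
  have [|_ _ [a <- ha] [b <- hb]|q _ [a <- ha]|t' t'r2|a /esym] := hN.
  - by exists 0; [exact: quotmod_proj0 | exact: suppin0].
  - by exists (a + b); [exact: quotmod_projD | exact: suppinD].
  - by exists (q * a); [exact: quotmod_projZ | exact: suppinM].
  - exists 'X_[sqfree (xset t')] => //; apply/suppinX; left.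
    by exists t' => //; rewrite mnmsupp_sqfree.
  rewrite scale_face_gen => /quotmod_projP/sr_idealP paI ha.
  have : suppin Q (p * 'X_[sqfree (xset t)]).
    rewrite -[_ * _](subrK a); apply: suppinD => //.
    by move=> u /paI[S SD Su]; right; exists S.
  move/suppinMX => h v /h; rewrite /Q mnmsuppD mnmsupp_sqfree => -[[t' t'r2 t'v]|[S SD Sv]].
    have /subsetPn[w wt' wNt] : ~~ (t' \subset t).
      apply: contraNN tNr2 => tt'; have /eqP <- // : t' == t.
      by rewrite eqEcard tt' -(leq_add2r #|~: t|) cardsC -(cardsC t') leq_add2l r2le.
    apply/set0Pn; exists (lshift s w); rewrite in_setI coface_l wNt /=.
    by have := subsetP t'v (lshift s w); rewrite mem_xset in_setU mem_xset (negPf wNt); apply.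
  (* If [v] avoids [coface t], then [S] lies in the facet of [t] and is a face. *)
  apply: contraNneq SD => v0.
  have vN z : z \in mnmsupp v -> z \notin coface t.
    by move=> zv; apply/negP => zt; have := in_set0 z; rewrite -v0 in_setI zt zv.
  have St : xpart S \subset t.
    apply/subsetP => w; rewrite inE => /(subsetP Sv).
    by rewrite in_setU mem_xset => /orP[//|/vN]; rewrite coface_l negbK.
  apply/coloured_complexP; split=> [|j]; first exact: hD.2 tD St.
  rewrite inE => /(subsetP Sv); rewrite in_setU mem_xset_r /= => /vN.
  rewrite coface_r negbK => /eqP t0; apply/eqP.
  by rewrite -subset0 -t0 setSI.
apply: scale_suppin hp => [|x y|q x|u]; [exact: gspan0|exact: gspanD|exact: gspanZ|].
case/set0Pn => z; rewrite in_setI; case: (split_ordP z) => a -> /andP[].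
  (* For [a] outside [t], multiplying by [x_a] gives the generator of [a |: t], adjoined earlier, or
     0 if this is not a face. *)
  rewrite coface_l => aNt au.
  have aS : xset (a |: t) \subset mnmsupp u :|: xset t.
    apply/subsetP => z'; case: (split_ordP z') => b ->; last by rewrite mem_xset_r.
    by rewrite mem_xset => /setU1P[->|bt]; rewrite in_setU ?au // mem_xset bt orbT.
  have [aD|aND] := boolP ((a |: t) \in D); last first.
    rewrite (nonface_scale_face_gen _ aS); first exact: gspan0.
    apply: contraNN aND => /coloured_complexP[].
    suff -> : xpart (xset (a |: t)) = a |: t by [].
    by apply/setP => w; rewrite inE mem_xset.
  have -> : ('X_[u] : R) *: face_gen t =
      ('X_[u + sqfree (xset t) - sqfree (xset (a |: t))] : R) *: face_gen (a |: t).
    rewrite !scale_face_gen -!mpolyXD submK //.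
    by rewrite sqfree_le mnmsuppD mnmsupp_sqfree.
  apply/gspanZ/gspan_gen/ltr2; first by rewrite mem_enum.
  by apply/proper_card; rewrite properC properE subsetUr subUset sub1set (negPf aNt).
(* For a colour [a] met by [t], the vertex [y_a] together with [t] is a nonface, so the product is
   0. *)
rewrite coface_r => ta au.
rewrite (nonface_scale_face_gen (S := rshift n a |: xset t)); first exact: gspan0.
  apply: contraNN ta => /coloured_complexP[_ /(_ a)].
  have -> : xpart (rshift n a |: xset t) = t.
    by apply/setP => w; rewrite inE in_setU1 eq_lrshift mem_xset.
  by rewrite inE in_setU1 eqxx => /(_ isT) ->.
by rewrite setSU // sub1set.
Qed.

Lemma face_resolution :
  exists F : graded_free_resolution (quotmod_deg I), forall i j,
    gcount (gcomplex_of F) i j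
      = (\sum_(t in D) (j == (#|t|%:Z + i%:Z)%R) * 'C(n, i))%N.
Proof.
pose r := sort (fun x y : {set 'I_n} => #|~: y| <= #|~: x|)%N (enum D).
have rD t : (t \in r) = (t \in D) by rewrite mem_sort mem_enum.
have [||C [h [rC cC]]] :=
  @linear_quotients k _ _ _ _ face_gen (fun t => #|t|%:Z) coface r
    (@graded_quotmod k _ Dchi).
- by move=> t _; exact: face_gen_deg.
- by move=> r1 t r2 /face_colon.
have [x|F cF] := resolution_of_resolves rC.
  rewrite -(quotmod_projK x) -[X in pi X]mulr1.
  have -> : 1 = 'X_[sqfree (xset set0)] :> R.
    by rewrite -mpolyX0; congr mpolyX; apply/mnmP => z; rewrite mnm0E mnmE [xset _]imset0 inE.
  by rewrite -scale_face_gen; apply/gspanZ/gspan_gen; rewrite rD; exact: hD.1.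
exists F => i j; rewrite cF cC (perm_big (enum D)) ?perm_sort // big_enum.
by apply: eq_bigr => t tD; rewrite card_coface.
Qed.

End FaceRing.

End ColouredComplex.

(** Faces are grouped by cardinality [j]; those with fewer than [i] vertices contribute 0. *)
Lemma sum_binomial_fnum (n N i : nat) (D : {set {set 'I_n}}) :
  (forall t, t \in D -> (#|t| <= N)%N) ->
  (\sum_(t in D) 'C(#|t|, i) = \sum_(i <= j < N.+1) 'C(j, i) * fnum D (j%:Z - 1)%R)%N.
Proof.
move=> le_N.
rewrite [RHS](eq_bigr (fun j => \sum_(t in D) 'C(j, i) * (#|t| == j)))%N; last first.
  move=> j _; rewrite -big_distrr /=; congr muln.
  rewrite /fnum -sum1_card big_mkcond [RHS]big_mkcond; apply: eq_bigr => t _.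
  rewrite inE /face_dim; case: (t \in D) => //=.
  by rewrite (inj_eq (addIr _)) eqz_nat; case: eqP.
rewrite exchange_big; apply: eq_bigr => t /le_N tN /=.
have [it|ti] := leqP i #|t|; last first.
  rewrite bin_small // big_nat_cond big1 // => j /andP[/andP[ij _] _].
  by rewrite (ltn_eqF (leq_trans ti ij)) muln0.
rewrite (bigD1_seq #|t|) ?iota_uniq //=; last by rewrite mem_index_iota it ltnS.
rewrite eqxx muln1 big1 ?addn0 // => j /negPf ne.
by rewrite eq_sym ne muln0.
Qed.

Theorem theorem4p7 (k : fieldType) (n s : nat) (d : int)
    (D : {set {set 'I_n}}) (chi : 'I_s -> {set 'I_n})
    (hD : simplicial_complex D) (hd : complex_dim D d) (hchi : colouring D chi) :
  let Dchi := coloured_complex D chi in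
  let I := sr_ideal k Dchi in
  let Idual := sr_ideal k (alexander_dual Dchi) in
  [/\ (forall i : nat,
         betti (submod Idual) (submod_deg Idual) i (i + n)%N%:Z
         = (\sum_(i <= j < (absz (d + 1)%R).+1) 'C(j, i) * fnum D (j%:Z - 1)%R)%N),
      (forall (i : nat) (j : int), j <> (i + n)%N%:Z ->
         betti (submod Idual) (submod_deg Idual) i j = 0%N),
      is_proj_dim (submod Idual) (d + 1)
    & is_regularity (quotmod I) (quotmod_deg I) (d + 1)].
Proof.
move=> Dchi I Idual.
have [[T TD Td] le_d] := hd; set N := absz _.
have TN : #|T| = N by rewrite /N -Td /face_dim; lia.
have le_N t : t \in D -> (#|t| <= N)%N.
  by move=> /le_d; rewrite /N -Td /face_dim; lia.
have dN : d + 1 = N%:Z by rewrite -TN -Td /face_dim; lia.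
have gI := @graded_submod k _ (alexander_dual Dchi).
have gQ := @graded_quotmod k _ Dchi.
have [F cF] := dual_resolution k hD hchi; have [G cG] := face_resolution k hD hchi.
have cF_off i j : j <> (i + n)%N%:Z -> gcount (gcomplex_of F) i j = 0%N.
  by move=> ne; rewrite cF big1 // => t _; case: eqP => // e; lia.
have cF_on i : gcount (gcomplex_of F) i (i + n)%N%:Z = (\sum_(t in D) 'C(#|t|, i))%N.
  rewrite cF; apply: eq_bigr => t _; case: eqP => [_|e]; first by rewrite mul1n.
  by case: e; lia.
have bF i j : betti (submod Idual) (submod_deg Idual) i j = tor_dim F i j.
  exact: betti_tor_dim.
have bG i j : betti (quotmod I) (quotmod_deg I) i j = tor_dim G i j.
  exact: betti_tor_dim.
split=> [i|i j ne||].
(* By linearity of the resolution, no generator of degree [i + n] sits in homological degree [i - 1]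
   or [i + 1]. *)
- rewrite bF tor_dim_count ?cF_on; first exact: sum_binomial_fnum.
    by apply: cF_off; lia.
  by move=> i' ->; apply: cF_off; lia.
- by rewrite bF; apply/eqP; rewrite -leqn0 -(cF_off _ _ ne); exact: tor_dim_le_count.
- have deg_F i (a : 'I_(gres_rank F i)) : gres_deg a = (i + n)%N%:Z.
    apply/eqP/negPn/negP => /eqP/cF_off/card0_eq/(_ a).
    by rewrite !inE eqxx.
  exists N; split=> // [|q].
    apply: (@proj_dim_le_resolution _ _ _ _ F) => i Ni.
    case E: (gres_rank F i) => [//|r].
    have a : 'I_(gres_rank F i) by rewrite E; exact: ord0.
    have : (0 < gcount (gcomplex_of F) i (i + n)%N%:Z)%N.
      by apply/card_gt0P; exists a; rewrite inE /= deg_F.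
    rewrite cF_on big1 // => t /le_N tN; apply: bin_small; exact: leq_ltn_trans tN Ni.
  apply: (@proj_dim_ge_resolution _ _ _ _ F) => //.
    (* Minimality: all entries of the differentials have degree 1, hence no constant coefficient. *)
    move=> i; apply/matrixP => a b; rewrite !mxE.
    apply: (homogz_coef0 (gres_diff_homog (g := F) a b)); rewrite !deg_F; lia.
  have : (0 < gcount (gcomplex_of F) N (N + n)%N%:Z)%N.
    by rewrite cF_on (bigD1 T) //= TN binn.
  by case/card_gt0P => a _; apply: leq_ltn_trans (ltn_ord a).
split.
  (* A face of maximal size contributes a generator here. None can cancel it: ['C(n, n.+1)] is 0,
     and in homological degree [n - 1] a face with [d + 2] vertices would be required. *)
  exists n, (n%:Z + d + 1); split; last by lia.
  rewrite bG tor_dim_count.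
  - apply/eqP; rewrite -lt0n cG (bigD1 T) //= binn TN muln1.
    by case: eqP => // e; case: e; lia.
  - by rewrite cG big1 // => t _; rewrite bin_small // muln0.
  - move=> n' n'E; rewrite cG big1 // => t /le_N tN; case: eqP => // e; lia.
move=> i j; rewrite bG => b0.
have : (0 < gcount (gcomplex_of G) i j)%N.
  by apply: leq_trans (tor_dim_le_count G i j); rewrite lt0n; apply/eqP.
rewrite cG lt0n => /eqP c0; rewrite Order.TotalTheory.leNgt; apply/negP => dj; apply: c0.
rewrite big1 // => t /le_N tN; case: eqP => // e; lia.
Qed.
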